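(* Let $k$ be any field, and let $E$ and $F$ be finite graphs with no sinks. Suppose there exist a $kE^0$--$kF^0$-bimodule $M$, a $kF^0$--$kE^0$-bimodule $N$, and a positive integer $n$ for which there exist bimodule isomorphisms $$\omega_E : M \otimes_{kF^0} N \to (kE^1)^{\otimes n}, \qquad \omega_F : N \otimes_{kE^0} M \to (kF^1)^{\otimes n},$$ $$\sigma_M : kE^1 \otimes_{kE^0} M \to M \otimes_{kF^0} kF^1, \qquad \sigma_N : kF^1 \otimes_{kF^0} N \to N \otimes_{kE^0} kE^1$$ such that $$(\omega_E\otimes \mathrm{id}_{kE^1})\circ(\sigma_M\#\sigma_N)=\nu_n^E\circ(\mathrm{id}_{kE^1}\otimes\omega_E)$$ as maps $kE^1\otimes_{kE^0}(M\otimes_{kF^0}N)\to (kE^1)^{\otimes n}\otimes_{kE^0}kE^1$, and $$(\omega_F\otimes \mathrm{id}_{kF^1})\circ(\sigma_N\#\sigma_M)=\nu_n^F\circ(\mathrm{id}_{kF^1}\otimes\omega_F)$$ as maps $kF^1\otimes_{kF^0}(N\otimes_{kE^0}M)\to (kF^1)^{\otimes n}\otimes_{kF^0}kF^1$. Then the Leavitt path algebras $L_k(E)$ and $L_k(F)$ are graded Morita equivalent.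
   Context: A (directed) graph $E=(E^0,E^1,s,r)$ consists of a vertex set $E^0$, an edge set $E^1$, and source and range maps $s,r:E^1\to E^0$. It is finite if $E^0$ and $E^1$ are finite; a vertex $v$ is a sink if $s^{-1}(v)=\emptyset$. $kE^0$ is the $k$-algebra with $k$-basis $E^0$ and product $vw=\delta_{v,w}v$. $kE^1$ is the $k$-vector space with basis $E^1$, a $kE^0$--$kE^0$-bimodule via $v\cdot e=\delta_{v,s(e)}e$ and $e\cdot w=\delta_{w,r(e)}e$. $(kE^1)^{\otimes n}$ is the $n$-fold tensor product over $kE^0$ (similarly for $F$). Bimodules over $k$-algebras are unital, and the left and right actions of $k$ agree. For bimodules ${}_RX_S$, ${}_SY_T$, ${}_TZ_U$, $\alpha_{X,Y,Z}:(X\otimes_SY)\otimes_TZ\to X\otimes_S(Y\otimes_TZ)$ is the associativity isomorphism $(x\otimes y)\otimes z\mapsto x\otimes(y\otimes z)$. Operation $\#$: let $E,F,G$ be finite graphs with no sinks, $M$ a $kE^0$--$kF^0$-bimodule, $N$ a $kF^0$--$kG^0$-bimodule, and $\sigma:kE^1\otimes_{kE^0}M\to M\otimes_{kF^0}kF^1$, $\psi:kF^1\otimes_{kF^0}N\to N\otimes_{kG^0}kG^1$ bimodule isomorphisms. Then $\sigma\#\psi: kE^1\otimes_{kE^0}(M\otimes_{kF^0}N)\to (M\otimes_{kF^0}N)\otimes_{kG^0}kG^1$ is the bimodule isomorphism $$\sigma\#\psi:=\alpha_{M,N,kG^1}^{-1}\circ(\mathrm{id}_M\otimes\psi)\circ\alpha_{M,kF^1,N}\circ(\sigma\otimes\mathrm{id}_N)\circ\alpha_{kE^1,M,N}^{-1}.$$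 For $m\ge 1$, $\nu_m^E: kE^1\otimes_{kE^0}(kE^1)^{\otimes m}\to(kE^1)^{\otimes m}\otimes_{kE^0}kE^1$ is the bimodule isomorphism $x_1\otimes(y_1\otimes\cdots\otimes y_m)\mapsto(x_1\otimes y_1\otimes\cdots\otimes y_{m-1})\otimes y_m$. The Leavitt path algebra $L_k(E)$ of a finite graph with no sinks is the $k$-algebra generated by $\{v: v\in E^0\}\cup\{e,e^*: e\in E^1\}$ subject to: $vu=\delta_{v,u}v$; $s(e)e=er(e)=e$; $r(e)e^*=e^*s(e)=e^*$; $e^*e'=\delta_{e,e'}r(e)$; and $v=\sum_{e\in s^{-1}(v)}ee^*$ for every $v\in E^0$. It is $\mathbb{Z}$-graded with $n$th component spanned by the elements $\alpha\beta^*$ where $\alpha,\beta$ are paths in $E$ with $\ell(\alpha)-\ell(\beta)=n$ (vertices being paths of length $0$). Graded Morita equivalence: for a $\mathbb{Z}$-graded ring $R$, $\mathsf{Gr}\text{-}R$ is the category of $\mathbb{Z}$-graded right $R$-modules with degree-preserving homomorphisms; for $\gamma\in\mathbb{Z}$, $\Psi_\gamma:\mathsf{Gr}\text{-}R\to\mathsf{Gr}\text{-}R$ sends $M$ to its suspension $M(\gamma)$, $M(\gamma)_g=M_{\gamma+g}$, and is the identity on morphisms. A functor $\Phi:\mathsf{Gr}\text{-}R\to\mathsf{Gr}\text{-}S$ is graded if $\Psi_\gamma(\Phi(M))=\Phi(\Psi_\gamma(M))$ as graded modules for all $M$ and $\gamma$. A functor $\varphi:\mathsf{Mod}\text{-}R\to\mathsf{Mod}\text{-}S$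 (categories of right modules) is graded if there is a graded functor $\Phi:\mathsf{Gr}\text{-}R\to\mathsf{Gr}\text{-}S$ with $U_S\circ\Phi=\varphi\circ U_R$, where $U_R,U_S$ are the functors forgetting the grading. $R$ and $S$ are graded Morita equivalent if either of the following two conditions holds (they are known to be equivalent, by a theorem of Hazrat): (geMod) there is a graded functor $\mathsf{Mod}\text{-}R\to\mathsf{Mod}\text{-}S$ that is an equivalence of categories; (geGr) there is a graded functor $\Phi:\mathsf{Gr}\text{-}R\to\mathsf{Gr}\text{-}S$ and a graded functor $\Gamma:\mathsf{Gr}\text{-}S\to\mathsf{Gr}\text{-}R$ such that $\Gamma\circ\Phi$ and $\Phi\circ\Gamma$ are naturally isomorphic to the identity functors. *)

(* Defs.v *)
From HB Require Import structures.
From mathcomp Require Import all_boot all_order all_algebra.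
From mathcomp Require Import boolp ring.
From mathcomp Require Import freeg.

Set Implicit Arguments.
Unset Strict Implicit.
Unset Printing Implicit Defensive.

Import GRing.Theory.
Local Open Scope ring_scope.

(* Associative unital algebras over k. The library's [algType] excludes the
   zero ring, which is the value of [kE0] and [leavitt] at the empty graph. *)

Record kalgebra (k : fieldType) := KAlgebra {
  ka_ring :> pzRingType;
  kscal : {rmorphism k -> ka_ring};
  kscalC : forall c a, kscal c * a = a * kscal c
}.
Arguments kscal {k A} : rename.

Record bimodule (k : fieldType) (A B : kalgebra k) := Bimodule {
  bm_sort :> zmodType;
  lact : A -> bm_sort -> bm_sort;
  ract : bm_sort -> B -> bm_sort;
  lactDl : forall a b x, lact (a + b) x = lact a x + lact b x;
  lactDr : forall a x y, lact a (x + y) = lact a x + lact a y;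
  lactM : forall a b x, lact (a * b) x = lact a (lact b x);
  lact1 : forall x, lact 1 x = x;
  ractDl : forall x y b, ract (x + y) b = ract x b + ract y b;
  ractDr : forall x a b, ract x (a + b) = ract x a + ract x b;
  ractM : forall x a b, ract x (a * b) = ract (ract x a) b;
  ract1 : forall x, ract x 1 = x;
  lractA : forall a x b, ract (lact a x) b = lact a (ract x b);
  lractk : forall (c : k) x, lact (kscal c) x = ract x (kscal c)
}.
Arguments lact {k A B X} : rename.
Arguments ract {k A B X} : rename.

Lemma morphD0 (V W : zmodType) (f : V -> W) : {morph f : x y / x + y} -> f 0 = 0.
Proof. by move=> fD; apply: (@addrI _ (f 0)); rewrite -fD !addr0. Qed.

Lemma morphDB (V W : zmodType) (f : V -> W) :
  {morph f : x y / x + y} -> {morph f : x y / x - y}.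
Proof. by move=> fD x y; apply: (@addIr _ (f y)); rewrite -fD !addrNK. Qed.

Record bihom (k : fieldType) (A B : kalgebra k) (X Y : bimodule A B) := Bihom {
  bh_fun :> X -> Y;
  bihomD : forall x y, bh_fun (x + y) = bh_fun x + bh_fun y;
  bihom_l : forall a x, bh_fun (lact a x) = lact a (bh_fun x);
  bihom_r : forall x b, bh_fun (ract x b) = ract (bh_fun x) b
}.

Record biiso (k : fieldType) (A B : kalgebra k) (X Y : bimodule A B) := Biiso {
  bi_hom :> bihom X Y;
  bi_bij : bijective bi_hom
}.

Section BihomTheory.
Context (k : fieldType) (A B : kalgebra k).
Implicit Types X Y Z : bimodule A B.

Definition bi_id X : bihom X X :=
  @Bihom k A B X X id (fun _ _ => erefl) (fun _ _ => erefl) (fun _ _ => erefl).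

Lemma bi_comp_subproof X Y Z (g : bihom Y Z) (f : bihom X Y) :
  [/\ forall x y, (g \o f) (x + y) = (g \o f) x + (g \o f) y,
      forall a x, (g \o f) (lact a x) = lact a ((g \o f) x)
    & forall x b, (g \o f) (ract x b) = ract ((g \o f) x) b].
Proof.
by split=> *; rewrite /= ?bihomD ?bihom_l ?bihom_r.
Qed.

Definition bi_comp X Y Z (g : bihom Y Z) (f : bihom X Y) : bihom X Z :=
  let: And3 D l r := bi_comp_subproof g f in Bihom D l r.

Lemma bi_compE X Y Z (g : bihom Y Z) (f : bihom X Y) x : bi_comp g f x = g (f x).
Proof. by rewrite /bi_comp; case: bi_comp_subproof. Qed.

End BihomTheory.

Inductive zgen (V : zmodType) (G : V -> Prop) : V -> Prop :=
| zgen_in x : G x -> zgen G x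
| zgen0 : zgen G 0
| zgenB x y : zgen G x -> zgen G y -> zgen G (x - y).

Section Subgroup.
Context (V : zmodType) (G : V -> Prop).

Definition subgroup (x : V) : bool := `[< zgen G x >].

Lemma subgroup_closed : zmod_closed subgroup.
Proof.
split; first by apply/asboolP; exact: zgen0.
by move=> x y /asboolP hx /asboolP hy; apply/asboolP; exact: zgenB.
Qed.

HB.instance Definition _ := GRing.isZmodClosed.Build V subgroup subgroup_closed.

Definition zspan : zmodClosed V := GRing.ZmodClosed.clone V subgroup _.

End Subgroup.

Section Tensor.
Context (k : fieldType) (A B C : kalgebra k).
Context (X : bimodule A B) (Y : bimodule B C).

Inductive tens_rel : {freeg (X * Y)%type / int} -> Prop :=
| tens_relDl x x' y : tens_rel (<<(x + x', y)>> - (<<(x, y)>> + <<(x', y)>>))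
| tens_relDr x y y' : tens_rel (<<(x, y + y')>> - (<<(x, y)>> + <<(x, y')>>))
| tens_relM x b y : tens_rel (<<(ract x b, y)>> - <<(x, lact b y)>>).

Definition tens_sort : zmodType := Quotient.quot (zspan tens_rel).

Definition tens_proj (D : {freeg (X * Y)%type / int}) : tens_sort :=
  (\pi_(Quotient.quot (zspan tens_rel)) D)%qT.

Definition tens (x : X) (y : Y) : tens_sort := tens_proj <<(x, y)>>.

Lemma tens_proj0 : tens_proj 0 = 0.
Proof. by rewrite /tens_proj raddf0. Qed.

Lemma tens_projB D D' : tens_proj (D - D') = tens_proj D - tens_proj D'.
Proof. by rewrite /tens_proj raddfB. Qed.

Lemma tens_projD D D' : tens_proj (D + D') = tens_proj D + tens_proj D'.
Proof. by rewrite /tens_proj raddfD. Qed.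

Lemma tens_projP D D' : zgen tens_rel (D - D') <-> tens_proj D = tens_proj D'.
Proof.
split=> [h | /eqP]; last by rewrite -Quotient.idealrBE => /asboolP.
by apply/eqP; rewrite -Quotient.idealrBE; apply/asboolP.
Qed.

Lemma tens_proj_rel D D' : tens_rel (D - D') -> tens_proj D = tens_proj D'.
Proof. by move=> h; apply/tens_projP; exact: zgen_in. Qed.

Lemma tensDl x x' y : tens (x + x') y = tens x y + tens x' y.
Proof. rewrite /tens -tens_projD; exact: tens_proj_rel (tens_relDl x x' y). Qed.

Lemma tensDr x y y' : tens x (y + y') = tens x y + tens x y'.
Proof. rewrite /tens -tens_projD; exact: tens_proj_rel (tens_relDr x y y'). Qed.

Lemma tensM x b y : tens (ract x b) y = tens x (lact b y).
Proof. exact: tens_proj_rel (tens_relM x b y). Qed.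

Lemma tens_ind (P : tens_sort -> Prop) :
  (forall x y, P (tens x y)) -> P 0 -> (forall t u, P t -> P u -> P (t - u)) ->
  forall t, P t.
Proof.
move=> Pt P0 PB t; rewrite -[t]reprK; move: (repr t) => D {t}.
have PD u v : P u -> P v -> P (u + v).
  by move=> Pu Pv; rewrite -[v]opprK -[- v]sub0r; apply: (PB) => //; exact: PB.
rewrite -[_ D]/(tens_proj D).
elim/freeg_ind_dom0: D => [|z [x y] D _ _ PDD].
  by rewrite tens_proj0.
rewrite tens_projD; apply: (PD) => //.
have PU n : P (tens_proj (<<(x, y)>> *+ n)).
  elim: n => [|n IH]; first by rewrite mulr0n tens_proj0.
  by rewrite mulrS tens_projD; apply: (PD) => //; exact: Pt.
rewrite -[z]intz -freegU_mulz; case: z => n; first exact: PU.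
by rewrite NegzE mulrNz -sub0r tens_projB tens_proj0; apply: (PB) => //; exact: PU.
Qed.

Record balanced (V : zmodType) (f : X -> Y -> V) : Prop := Balanced {
  balDl : forall x x' y, f (x + x') y = f x y + f x' y;
  balDr : forall x y y', f x (y + y') = f x y + f x y';
  balM : forall x b y, f (ract x b) y = f x (lact b y)
}.

(* Meaningful only when f is balanced, see [tens_liftE]. *)
Definition tens_lift (V : zmodType) (f : X -> Y -> V) (t : tens_sort) : V :=
  fglift (M := zmodule V) (fun xy => f xy.1 xy.2) (repr t).

Section Lift.
Context (V : zmodType) (f : X -> Y -> V) (hf : balanced f).
Let F := fglift (M := zmodule V) (fun xy => f xy.1 xy.2).

Let FB D D' : F (D - D') = F D - F D'.
Proof. exact: lift_is_additive. Qed.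

Let F0 : F 0 = 0.
Proof. by rewrite -(subrr 0) FB subrr. Qed.

Let FD D D' : F (D + D') = F D + F D'.
Proof. by rewrite -[D' in LHS]opprK FB -[- D']sub0r FB F0 sub0r opprK. Qed.

Let FU x y : F <<(x, y)>> = f x y.
Proof. by rewrite /F liftU scale1r. Qed.

Let F_rel D : zgen tens_rel D -> F D = 0.
Proof.
elim=> [_ [] * | | ? ? _ h _ h'].
- by rewrite FB FD !FU (balDl hf) subrr.
- by rewrite FB FD !FU (balDr hf) subrr.
- by rewrite FB !FU (balM hf) subrr.
- exact: F0.
- by rewrite FB h h' subrr.
Qed.

Let F_proj D : tens_lift f (tens_proj D) = F D.
Proof.
apply/eqP; rewrite -subr_eq0; apply/eqP.
by rewrite -[tens_lift _ _]/(F _) -FB; apply/F_rel/tens_projP; rewrite [LHS]reprK.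
Qed.

Lemma tens_liftE x y : tens_lift f (tens x y) = f x y.
Proof. by rewrite F_proj FU. Qed.

Lemma tens_liftB t u : tens_lift f (t - u) = tens_lift f t - tens_lift f u.
Proof.
rewrite -[t]reprK -[u]reprK -!/(tens_proj _) -tens_projB !F_proj; exact: FB.
Qed.

Lemma tens_liftD t u : tens_lift f (t + u) = tens_lift f t + tens_lift f u.
Proof.
rewrite -[t]reprK -[u]reprK -!/(tens_proj _) -tens_projD !F_proj; exact: FD.
Qed.

End Lift.

End Tensor.

Lemma tens_ext (k : fieldType) (A B C : kalgebra k) (X : bimodule A B) (Y : bimodule B C)
    (V : zmodType) (f g : tens_sort X Y -> V) :
  {morph f : t u / t + u} -> {morph g : t u / t + u} ->
  (forall x y, f (tens x y) = g (tens x y)) -> f =1 g.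
Proof.
move=> fD gD fg; elim/tens_ind => // [|t u ht hu].
  by rewrite (morphD0 fD) (morphD0 gD).
by rewrite (morphDB fD) (morphDB gD) ht hu.
Qed.

Section TensorBimodule.
Context (k : fieldType) (A B C : kalgebra k).
Context (X : bimodule A B) (Y : bimodule B C).
Notation XY := (tens_sort X Y).

Definition tens_lact (a : A) : XY -> XY := tens_lift (fun x y => tens (lact a x) y).
Definition tens_ract (t : XY) (c : C) : XY := tens_lift (fun x y => tens x (ract y c)) t.

Let lbal a : balanced (fun (x : X) (y : Y) => tens (lact a x) y).
Proof.
by split=> *; rewrite ?lactDr ?tensDl ?tensDr // -lractA tensM.
Qed.

Let rbal c : balanced (fun (x : X) (y : Y) => tens x (ract y c)).
Proof.
by split=> *; rewrite ?ractDl ?tensDl ?tensDr // tensM lractA.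
Qed.

Lemma tens_lactE a x y : tens_lact a (tens x y) = tens (lact a x) y.
Proof. exact: tens_liftE (lbal a) x y. Qed.

Lemma tens_ractE x y c : tens_ract (tens x y) c = tens x (ract y c).
Proof. exact: tens_liftE (rbal c) x y. Qed.

Lemma tens_lactDr a : {morph tens_lact a : t u / t + u}.
Proof. exact: tens_liftD (lbal a). Qed.

Lemma tens_ractDl c : {morph tens_ract^~ c : t u / t + u}.
Proof. exact: tens_liftD (rbal c). Qed.

Let addfD (f g : XY -> XY) : {morph f : t u / t + u} -> {morph g : t u / t + u} ->
  {morph (fun t => f t + g t) : t u / t + u}.
Proof. by move=> fD gD t u; rewrite fD gD addrACA. Qed.

Let compD (f g : XY -> XY) : {morph f : t u / t + u} -> {morph g : t u / t + u} ->
  {morph (fun t => f (g t)) : t u / t + u}.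
Proof. by move=> fD gD t u; rewrite gD fD. Qed.

Let lDl a b t : tens_lact (a + b) t = tens_lact a t + tens_lact b t.
Proof.
apply: (tens_ext (tens_lactDr _) (addfD (tens_lactDr a) (tens_lactDr b))) => x y.
by rewrite !tens_lactE lactDl tensDl.
Qed.

Let lM a b t : tens_lact (a * b) t = tens_lact a (tens_lact b t).
Proof.
apply: (tens_ext (tens_lactDr _) (compD (tens_lactDr a) (tens_lactDr b))) => x y.
by rewrite !tens_lactE lactM.
Qed.

Let l1 t : tens_lact 1 t = t.
Proof.
by apply: (tens_ext (tens_lactDr _) (g := id)) => // x y; rewrite tens_lactE lact1.
Qed.

Let rDr t a b : tens_ract t (a + b) = tens_ract t a + tens_ract t b.
Proof.
apply: (tens_ext (tens_ractDl _) (addfD (tens_ractDl a) (tens_ractDl b))) => x y.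
by rewrite !tens_ractE ractDr tensDr.
Qed.

Let rM t a b : tens_ract t (a * b) = tens_ract (tens_ract t a) b.
Proof.
apply: (tens_ext (tens_ractDl _) (compD (tens_ractDl b) (tens_ractDl a))) => x y.
by rewrite !tens_ractE ractM.
Qed.

Let r1 t : tens_ract t 1 = t.
Proof.
by apply: (tens_ext (tens_ractDl _) (g := id)) => // x y; rewrite tens_ractE ract1.
Qed.

Let lr a t c : tens_ract (tens_lact a t) c = tens_lact a (tens_ract t c).
Proof.
apply: (tens_ext (compD (tens_ractDl c) (tens_lactDr a)) (compD (tens_lactDr a) (tens_ractDl c))) => x y.
by rewrite !(tens_lactE, tens_ractE).
Qed.

Let lrk (c : k) t : tens_lact (kscal c) t = tens_ract t (kscal c).
Proof.
apply: (tens_ext (tens_lactDr _) (tens_ractDl _)) => x y.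
by rewrite tens_lactE tens_ractE lractk tensM lractk.
Qed.

Canonical tensor : bimodule A C :=
  @Bimodule k A C XY tens_lact tens_ract lDl tens_lactDr lM l1
    (fun t u c => tens_ractDl c t u) rDr rM r1 lr lrk.

End TensorBimodule.

Notation "X ⊗ Y" := (tensor X Y) (at level 40, left associativity).

Section TensorLift.
Context (k : fieldType) (A B C : kalgebra k).
Context (X : bimodule A B) (Y : bimodule B C) (Z : bimodule A C).

Record bibalanced (f : X -> Y -> Z) : Prop := Bibalanced {
  bibal :> balanced f;
  bibal_l : forall a x y, f (lact a x) y = lact a (f x y);
  bibal_r : forall x y c, f x (ract y c) = ract (f x y) c
}.

Lemma bi_lift_l f (hf : bibalanced f) a (t : X ⊗ Y) :
  tens_lift f (lact a t) = lact a (tens_lift f t).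
Proof.
apply: (@tens_ext _ _ _ _ X Y Z (fun t => tens_lift f (tens_lact a t))
    (fun t => lact a (tens_lift f t))) => [u v|u v|x y].
- by rewrite tens_lactDr (tens_liftD hf).
- by rewrite (tens_liftD hf) lactDr.
- by rewrite tens_lactE !(tens_liftE hf) (bibal_l hf).
Qed.

Lemma bi_lift_r f (hf : bibalanced f) (t : X ⊗ Y) c :
  tens_lift f (ract t c) = ract (tens_lift f t) c.
Proof.
apply: (@tens_ext _ _ _ _ X Y Z (fun t => tens_lift f (tens_ract t c))
    (fun t => ract (tens_lift f t) c)) => [u v|u v|x y].
- by rewrite tens_ractDl (tens_liftD hf).
- by rewrite (tens_liftD hf) ractDl.
- by rewrite tens_ractE !(tens_liftE hf) (bibal_r hf).
Qed.

Definition bi_lift f (hf : bibalanced f) : bihom (X ⊗ Y) Z :=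
  @Bihom k A C (X ⊗ Y) Z (tens_lift f) (tens_liftD hf) (bi_lift_l hf) (bi_lift_r hf).

Lemma bi_liftE f hf x y : @bi_lift f hf (tens x y) = f x y.
Proof. exact: (tens_liftE hf). Qed.

Lemma bihom_ext (f g : bihom (X ⊗ Y) Z) :
  (forall x y, f (tens x y) = g (tens x y)) -> f =1 g.
Proof. exact: tens_ext (bihomD f) (bihomD g). Qed.

End TensorLift.

Section TensorMap.
Context (k : fieldType) (A B C : kalgebra k).
Context (X X' : bimodule A B) (Y Y' : bimodule B C).
Context (f : bihom X X') (g : bihom Y Y').

Lemma tens_map_bal : bibalanced (fun x y => tens (f x) (g y) : X' ⊗ Y').
Proof.
split=> [|a x y|x y c]; last 2 first.
- by rewrite bihom_l -tens_lactE.
- by rewrite bihom_r -tens_ractE.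
by split=> *; rewrite ?bihomD ?tensDl ?tensDr // bihom_r bihom_l tensM.
Qed.

Definition tens_map : bihom (X ⊗ Y) (X' ⊗ Y') := bi_lift tens_map_bal.

Lemma tens_mapE x y : tens_map (tens x y) = tens (f x) (g y).
Proof. exact: bi_liftE. Qed.

End TensorMap.

Notation "f ⊗m g" := (tens_map f g) (at level 40, left associativity).

Section Associator.
Context (k : fieldType) (A B C D : kalgebra k).
Context (X : bimodule A B) (Y : bimodule B C) (Z : bimodule C D).

Lemma assoc1_bal z : balanced (fun x y => tens x (tens y z) : X ⊗ (Y ⊗ Z)).
Proof.
by split=> *; rewrite ?tensDl ?tensDr // tensM -tens_lactE.
Qed.

Lemma assoc_bal : bibalanced (fun (t : X ⊗ Y) (z : Z) =>
  tens_lift (fun x y => tens x (tens y z)) t : X ⊗ (Y ⊗ Z)).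
Proof.
have LD z := tens_liftD (assoc1_bal z).
have LE z := tens_liftE (assoc1_bal z).
split=> [|a t z|t z d].
- split=> [t u z|t z z'|t c z]; first exact: LD.
  + pose F z t : X ⊗ (Y ⊗ Z) := tens_lift (fun x y => tens x (tens y z)) t.
    apply: (@tens_ext _ _ _ _ X Y _ (F (z + z')) (fun t => F z t + F z' t)) => [||x y].
    * exact: LD.
    * by move=> u v; rewrite /F !LD addrACA.
    * by rewrite /F !LE !tensDr.
  + pose F z t : X ⊗ (Y ⊗ Z) := tens_lift (fun x y => tens x (tens y z)) t.
    apply: (@tens_ext _ _ _ _ X Y _ (fun t => F z (tens_ract t c)) (F (lact c z))) => [||x y].
    * by move=> u v; rewrite tens_ractDl /F LD.
    * exact: LD.
    * by rewrite tens_ractE /F !LE tensM.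
- pose F t : X ⊗ (Y ⊗ Z) := tens_lift (fun x y => tens x (tens y z)) t.
  apply: (@tens_ext _ _ _ _ X Y _ (fun t => F (tens_lact a t)) (fun t => tens_lact a (F t)))
    => [u v|u v|x y].
  + by rewrite tens_lactDr /F LD.
  + by rewrite /F LD tens_lactDr.
  + by rewrite tens_lactE /F !LE tens_lactE.
- pose F z t : X ⊗ (Y ⊗ Z) := tens_lift (fun x y => tens x (tens y z)) t.
  apply: (@tens_ext _ _ _ _ X Y _ (F (ract z d)) (fun t => tens_ract (F z t) d))
    => [||x y].
  + exact: LD.
  + by move=> u v; rewrite /F LD tens_ractDl.
  + by rewrite /F !LE tens_ractE; congr tens; exact/esym/tens_ractE.
Qed.

Definition assoc : bihom (X ⊗ Y ⊗ Z) (X ⊗ (Y ⊗ Z)) := bi_lift assoc_bal.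

Lemma assocE x y z : assoc (tens (tens x y) z) = tens x (tens y z).
Proof. by rewrite bi_liftE (tens_liftE (assoc1_bal z)). Qed.

Lemma assoc_inv1_bal x : balanced (fun y z => tens (tens x y) z : X ⊗ Y ⊗ Z).
Proof.
by split=> *; rewrite ?tensDl ?tensDr ?tensDl // -tensM -tens_ractE.
Qed.

Lemma assoc_inv_bal : bibalanced (fun (x : X) (t : Y ⊗ Z) =>
  tens_lift (fun y z => tens (tens x y) z) t : X ⊗ Y ⊗ Z).
Proof.
have LD x := tens_liftD (assoc_inv1_bal x).
have LE x := tens_liftE (assoc_inv1_bal x).
split=> [|a x t|x t d].
- split=> [x x' t|x t u|x b t]; last 1 first.
  + pose F x t : X ⊗ Y ⊗ Z := tens_lift (fun y z => tens (tens x y) z) t.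
    apply: (@tens_ext _ _ _ _ Y Z _ (F (ract x b)) (fun t => F x (tens_lact b t)))
      => [||y z].
    * exact: LD.
    * by move=> u v; rewrite tens_lactDr /F LD.
    * by rewrite tens_lactE /F !LE tensM.
  + pose F x t : X ⊗ Y ⊗ Z := tens_lift (fun y z => tens (tens x y) z) t.
    apply: (@tens_ext _ _ _ _ Y Z _ (F (x + x')) (fun t => F x t + F x' t)) => [||y z].
    * exact: LD.
    * by move=> u v; rewrite /F !LD addrACA.
    * by rewrite /F !LE !tensDl.
  + exact: LD.
- pose F x t : X ⊗ Y ⊗ Z := tens_lift (fun y z => tens (tens x y) z) t.
  apply: (@tens_ext _ _ _ _ Y Z _ (F (lact a x)) (fun t => tens_lact a (F x t)))
    => [||y z].
  + exact: LD.
  + by move=> u v; rewrite /F LD tens_lactDr.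
  + by rewrite /F !LE tens_lactE; congr tens; exact/esym/tens_lactE.
- pose F t : X ⊗ Y ⊗ Z := tens_lift (fun y z => tens (tens x y) z) t.
  apply: (@tens_ext _ _ _ _ Y Z _ (fun t => F (tens_ract t d)) (fun t => tens_ract (F t) d))
    => [u v|u v|y z].
  + by rewrite tens_ractDl /F LD.
  + by rewrite /F LD tens_ractDl.
  + by rewrite tens_ractE /F !LE tens_ractE.
Qed.

Definition assoc_inv : bihom (X ⊗ (Y ⊗ Z)) (X ⊗ Y ⊗ Z) := bi_lift assoc_inv_bal.

Lemma assoc_invE x y z : assoc_inv (tens x (tens y z)) = tens (tens x y) z.
Proof. by rewrite bi_liftE (tens_liftE (assoc_inv1_bal x)). Qed.

Lemma assocK : cancel assoc assoc_inv.
Proof.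
move=> t; rewrite -bi_compE; apply: (bihom_ext (g := bi_id _)) t => t z.
rewrite bi_compE /=.
apply: (tens_ext (f := fun t => assoc_inv (assoc (tens t z)))
  (g := fun t => tens t z) _ _ _ t) => [u v|u v|x y].
- by rewrite tensDl !bihomD.
- exact: tensDl.
- by rewrite assocE assoc_invE.
Qed.

Lemma assoc_invK : cancel assoc_inv assoc.
Proof.
move=> t; rewrite -bi_compE; apply: (bihom_ext (g := bi_id _)) t => x t.
rewrite bi_compE /=.
apply: (tens_ext (f := fun t => assoc (assoc_inv (tens x t)))
  (g := fun t => tens x t) _ _ _ t) => [u v|u v|y z].
- by rewrite tensDr !bihomD.
- exact: tensDr.
- by rewrite assoc_invE assocE.
Qed.

End Associator.

Record digraph := Digraph {
  vert : finType;
  edge : finType;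
  src : edge -> vert;
  rng : edge -> vert
}.
Arguments src {E} : rename.
Arguments rng {E} : rename.

Definition no_sinks (E : digraph) := forall v : vert E, exists e : edge E, src e = v.

Section GraphBimodules.
Context (k : fieldType) (E : digraph).

(* Functions on the vertices with pointwise product: the indicator functions
   [kvert v] form a basis and multiply by v w = delta_{v,w} v. *)
Definition kE0_ring : pzRingType := {ffun vert E -> k}.

Definition kE0_scal (c : k) : kE0_ring := [ffun=> c].

Lemma kE0_scal_zmod : zmod_morphism kE0_scal.
Proof. by move=> c d; apply/ffunP=> v; rewrite !ffunE. Qed.

Lemma kE0_scal_monoid : monoid_morphism kE0_scal.
Proof. by split=> [|c d]; apply/ffunP=> v; rewrite !ffunE. Qed.

HB.instance Definition _ := GRing.isZmodMorphism.Build k kE0_ring kE0_scal kE0_scal_zmod.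
HB.instance Definition _ := GRing.isMonoidMorphism.Build k kE0_ring kE0_scal kE0_scal_monoid.

Lemma kE0_scalC c (a : kE0_ring) : kE0_scal c * a = a * kE0_scal c.
Proof. by apply/ffunP=> v; rewrite !ffunE mulrC. Qed.

Definition kE0 : kalgebra k := @KAlgebra k kE0_ring kE0_scal kE0_scalC.

Definition kvert (v : vert E) : kE0 := [ffun w => (w == v)%:R : k].

Lemma kvertM v w : kvert v * kvert w = if v == w then kvert v else 0.
Proof.
apply/ffunP=> u; rewrite !ffunE.
have [->|vw] := eqVneq v w; first by rewrite !ffunE -natrM mulnb andbb.
by rewrite ffunE; have [->|] := eqVneq u v; rewrite ?(negPf vw) ?mulr0 ?mul0r.
Qed.

Definition kE1_sort : zmodType := {ffun edge E -> k}.

Definition kedge (e : edge E) : kE1_sort := [ffun f => (f == e)%:R : k].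

Definition kE1_lact (a : kE0) (x : kE1_sort) : kE1_sort :=
  [ffun e => (a : {ffun vert E -> k}) (src e) * (x : {ffun edge E -> k}) e].

Definition kE1_ract (x : kE1_sort) (b : kE0) : kE1_sort :=
  [ffun e => (x : {ffun edge E -> k}) e * (b : {ffun vert E -> k}) (rng e)].

Lemma kE1_lact_basis v e :
  kE1_lact (kvert v) (kedge e) = if v == src e then kedge e else 0.
Proof.
apply/ffunP=> f; rewrite !ffunE.
have [->|vw] := eqVneq v (src e); rewrite !ffunE; have [->|] := eqVneq f e.
- by rewrite eqxx mulr1.
- by rewrite mulr0.
- by rewrite eq_sym (negPf vw) mul0r.
- by rewrite mulr0.
Qed.

Lemma kE1_ract_basis v e :
  kE1_ract (kedge e) (kvert v) = if v == rng e then kedge e else 0.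
Proof.
apply/ffunP=> f; rewrite !ffunE.
have [->|vw] := eqVneq v (rng e); rewrite !ffunE; have [->|] := eqVneq f e.
- by rewrite eqxx mulr1.
- by rewrite mul0r.
- by rewrite eq_sym (negPf vw) mulr0.
- by rewrite mul0r.
Qed.

Lemma kE1_lactDl a b x : kE1_lact (a + b) x = kE1_lact a x + kE1_lact b x.
Proof. by apply/ffunP=> e; rewrite !ffunE mulrDl. Qed.
Lemma kE1_lactDr a x y : kE1_lact a (x + y) = kE1_lact a x + kE1_lact a y.
Proof. by apply/ffunP=> e; rewrite !ffunE mulrDr. Qed.
Lemma kE1_lactM a b x : kE1_lact (a * b) x = kE1_lact a (kE1_lact b x).
Proof. by apply/ffunP=> e; rewrite !ffunE mulrA. Qed.
Lemma kE1_lact1 x : kE1_lact 1 x = x.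
Proof. by apply/ffunP=> e; rewrite !ffunE mul1r. Qed.
Lemma kE1_ractDl x y b : kE1_ract (x + y) b = kE1_ract x b + kE1_ract y b.
Proof. by apply/ffunP=> e; rewrite !ffunE mulrDl. Qed.
Lemma kE1_ractDr x a b : kE1_ract x (a + b) = kE1_ract x a + kE1_ract x b.
Proof. by apply/ffunP=> e; rewrite !ffunE mulrDr. Qed.
Lemma kE1_ractM x a b : kE1_ract x (a * b) = kE1_ract (kE1_ract x a) b.
Proof. by apply/ffunP=> e; rewrite !ffunE mulrA. Qed.
Lemma kE1_ract1 x : kE1_ract x 1 = x.
Proof. by apply/ffunP=> e; rewrite !ffunE mulr1. Qed.
Lemma kE1_lractA a x b : kE1_ract (kE1_lact a x) b = kE1_lact a (kE1_ract x b).
Proof. by apply/ffunP=> e; rewrite !ffunE mulrA. Qed.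
Lemma kE1_lractk (c : k) x :
  kE1_lact (kscal c : kE0) x = kE1_ract x (kscal c : kE0).
Proof. by apply/ffunP=> e; rewrite !ffunE mulrC. Qed.

Definition kE1 : bimodule kE0 kE0 :=
  @Bimodule k kE0 kE0 kE1_sort kE1_lact kE1_ract kE1_lactDl kE1_lactDr kE1_lactM
    kE1_lact1 kE1_ractDl kE1_ractDr kE1_ractM kE1_ract1 kE1_lractA kE1_lractk.

(* [kE1pow n] is the n-fold tensor power of kE1 over kE0, bracketed to the left,
   for n >= 1; the value at n = 0 is junk. *)
Fixpoint kE1powS (m : nat) : bimodule kE0 kE0 :=
  if m is m'.+1 then kE1powS m' ⊗ kE1 else kE1.

Definition kE1pow (n : nat) := kE1powS n.-1.

(* x (x) (y_1 (x) ... (x) y_n) |-> (x (x) y_1 (x) ... (x) y_{n-1}) (x) y_n,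
   see [nu_pure]. *)
Fixpoint nuS (m : nat) : bihom (kE1 ⊗ kE1powS m) (kE1powS m ⊗ kE1) :=
  if m is m'.+1 return bihom (kE1 ⊗ kE1powS m) (kE1powS m ⊗ kE1)
  then bi_comp (nuS m' ⊗m bi_id kE1) (assoc_inv kE1 (kE1powS m') kE1)
  else bi_id (kE1 ⊗ kE1).

Definition nu (n : nat) : bihom (kE1 ⊗ kE1pow n) (kE1pow n ⊗ kE1) := nuS n.-1.

(* y 0 (x) ... (x) y m *)
Fixpoint pureS (m : nat) (y : nat -> kE1) : kE1powS m :=
  if m is m'.+1 return kE1powS m then tens (pureS m' y) (y m) else y 0%N.

Lemma nu_pure (m : nat) (x : kE1) (y : nat -> kE1) :
  nu m.+1 (tens x (pureS m y)) =
  tens (pureS m (fun i => if i is j.+1 then y j else x)) (y m).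
Proof.
rewrite /nu /=; elim: m => [|m IH] //=.
by rewrite bi_compE assoc_invE tens_mapE IH.
Qed.

End GraphBimodules.

Section Sharp.
Context (k : fieldType) (E F G : digraph).
Context (M : bimodule (kE0 k E) (kE0 k F)) (N : bimodule (kE0 k F) (kE0 k G)).

Definition sharp (sigma : bihom (kE1 k E ⊗ M) (M ⊗ kE1 k F))
    (psi : bihom (kE1 k F ⊗ N) (N ⊗ kE1 k G)) :
    bihom (kE1 k E ⊗ (M ⊗ N)) (M ⊗ N ⊗ kE1 k G) :=
  bi_comp (assoc_inv M N (kE1 k G))
 (bi_comp (bi_id M ⊗m psi)
 (bi_comp (assoc M (kE1 k F) N)
 (bi_comp (sigma ⊗m bi_id N)
          (assoc_inv (kE1 k E) M N)))).

End Sharp.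

Record is_grading (V : zmodType) (C : int -> V -> Prop) : Prop := IsGrading {
  grading0 : forall i, C i 0;
  gradingB : forall i x y, C i x -> C i y -> C i (x - y);
  grading_sum : forall x, exists s : seq (int * V),
    (forall p, p \in s -> C p.1 p.2) /\ x = \sum_(p <- s) p.2;
  grading_free : forall (s : seq int) (y : int -> V), uniq s ->
    (forall i, C i (y i)) -> \sum_(i <- s) y i = 0 -> forall i, i \in s -> y i = 0
}.

Record gradedRing := GradedRing {
  gr_ring :> pzRingType;
  gr_comp : int -> gr_ring -> Prop;
  gr_grading : is_grading gr_comp;
  gr_mul : forall i j a b, gr_comp i a -> gr_comp j b -> gr_comp (i + j) (a * b)
}.

(* The Leavitt path algebra consists of the terms in the generators modulo the
   congruence generated by the axioms of (not necessarily unital) associative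
   k-algebras and the defining relations; its unit is the sum of the vertices.
   [lc_CK2] is imposed at every vertex, so the construction is the Leavitt path
   algebra only for graphs with no sinks. *)

Inductive lterm (k : Type) (E : digraph) :=
| LVert of vert E
| LEdge of edge E
| LGhost of edge E
| LZero
| LAdd of lterm k E & lterm k E
| LOpp of lterm k E
| LScale of k & lterm k E
| LMul of lterm k E & lterm k E.
Arguments LVert {k E}.
Arguments LEdge {k E}.
Arguments LGhost {k E}.
Arguments LZero {k E}.
Arguments LAdd {k E}.
Arguments LOpp {k E}.
Arguments LScale {k E}.
Arguments LMul {k E}.

HB.instance Definition _ k E := gen_eqMixin (lterm k E).
HB.instance Definition _ k E := gen_choiceMixin (lterm k E).

Definition lsum (k : Type) (E : digraph) (s : seq (lterm k E)) : lterm k E := foldr LAdd LZero s.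

Section LeavittRel.
Context (k : fieldType) (E : digraph).
Implicit Types (t u w : lterm k E) (c d : k) (v : vert E) (e f : edge E).

Inductive lcong : lterm k E -> lterm k E -> Prop :=
| lc_refl t : lcong t t
| lc_sym t u : lcong t u -> lcong u t
| lc_trans t u w : lcong t u -> lcong u w -> lcong t w
| lc_add t t' u u' : lcong t t' -> lcong u u' -> lcong (LAdd t u) (LAdd t' u')
| lc_opp t t' : lcong t t' -> lcong (LOpp t) (LOpp t')
| lc_scale c t t' : lcong t t' -> lcong (LScale c t) (LScale c t')
| lc_mul t t' u u' : lcong t t' -> lcong u u' -> lcong (LMul t u) (LMul t' u')
| lc_addA t u w : lcong (LAdd t (LAdd u w)) (LAdd (LAdd t u) w)
| lc_addC t u : lcong (LAdd t u) (LAdd u t)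
| lc_add0 t : lcong (LAdd LZero t) t
| lc_addN t : lcong (LAdd (LOpp t) t) LZero
| lc_scaleA c d t : lcong (LScale c (LScale d t)) (LScale (c * d) t)
| lc_scale1 t : lcong (LScale 1 t) t
| lc_scaleDr c t u : lcong (LScale c (LAdd t u)) (LAdd (LScale c t) (LScale c u))
| lc_scaleDl c d t : lcong (LScale (c + d) t) (LAdd (LScale c t) (LScale d t))
| lc_mulA t u w : lcong (LMul t (LMul u w)) (LMul (LMul t u) w)
| lc_mulDl t u w : lcong (LMul (LAdd t u) w) (LAdd (LMul t w) (LMul u w))
| lc_mulDr t u w : lcong (LMul t (LAdd u w)) (LAdd (LMul t u) (LMul t w))
| lc_scaleMl c t u : lcong (LScale c (LMul t u)) (LMul (LScale c t) u)
| lc_scaleMr c t u : lcong (LScale c (LMul t u)) (LMul t (LScale c u))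
| lc_vert v v' : lcong (LMul (LVert v) (LVert v')) (if v == v' then LVert v else LZero)
| lc_src e : lcong (LMul (LVert (src e)) (LEdge e)) (LEdge e)
| lc_rng e : lcong (LMul (LEdge e) (LVert (rng e))) (LEdge e)
| lc_rngV e : lcong (LMul (LVert (rng e)) (LGhost e)) (LGhost e)
| lc_srcV e : lcong (LMul (LGhost e) (LVert (src e))) (LGhost e)
| lc_CK1 e f : lcong (LMul (LGhost e) (LEdge f)) (if e == f then LVert (rng e) else LZero)
| lc_CK2 v : lcong (LVert v)
    (lsum [seq LMul (LEdge e) (LGhost e) | e <- enum (edge E) & src e == v]).

Definition lcongb t u : bool := `[< lcong t u >].

Lemma lcongb_equiv : equiv_class_of lcongb.
Proof.
split=> [t|t u|u t w].
- exact/asboolP/lc_refl.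
- by apply/asboolP/asboolP; exact: lc_sym.
- by move=> /asboolP tu /asboolP uw; apply/asboolP; exact: lc_trans tu uw.
Qed.

Canonical lcongb_equivRel := EquivRelPack lcongb_equiv.
Canonical lcongb_encModRel := defaultEncModRel lcongb.

Definition leavitt_sort := {eq_quot lcongb}%qT.
HB.instance Definition _ := Choice.on leavitt_sort.

End LeavittRel.

Section LeavittAlgebra.
Context (k : fieldType) (E : digraph).
Notation L := (leavitt_sort k E).
Notation T := (lterm k E).

Definition lcl (t : T) : L := (\pi_(leavitt_sort k E) t)%qT.

Lemma lclP t u : lcl t = lcl u <-> lcong t u.
Proof.
split=> [/eqP|h]; first by rewrite /lcl eqmodE => /asboolP.
by apply/eqP; rewrite /lcl eqmodE; apply/asboolP.
Qed.

Lemma lclK (x : L) : lcl (repr x) = x.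
Proof. exact: reprK. Qed.

Lemma repr_lcl t : lcong (repr (lcl t)) t.
Proof. by apply/lclP; rewrite lclK. Qed.

Definition Ladd (x y : L) : L := lcl (LAdd (repr x) (repr y)).
Definition Lopp (x : L) : L := lcl (LOpp (repr x)).
Definition Lscale (c : k) (x : L) : L := lcl (LScale c (repr x)).
Definition Lmul (x y : L) : L := lcl (LMul (repr x) (repr y)).
Definition Lone : L := lcl (lsum [seq LVert v | v <- enum (vert E)]).

Lemma LaddE t u : Ladd (lcl t) (lcl u) = lcl (LAdd t u).
Proof. by apply/lclP/lc_add; exact: repr_lcl. Qed.
Lemma LoppE t : Lopp (lcl t) = lcl (LOpp t).
Proof. by apply/lclP/lc_opp; exact: repr_lcl. Qed.
Lemma LscaleE c t : Lscale c (lcl t) = lcl (LScale c t).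
Proof. by apply/lclP/lc_scale; exact: repr_lcl. Qed.
Lemma LmulE t u : Lmul (lcl t) (lcl u) = lcl (LMul t u).
Proof. by apply/lclP/lc_mul; exact: repr_lcl. Qed.

Let LE := (LaddE, LoppE, LscaleE, LmulE).

Lemma LaddA : associative Ladd.
Proof.
by move=> x y z; rewrite -[x]lclK -[y]lclK -[z]lclK !LE; apply/lclP; constructor.
Qed.
Lemma LaddC : commutative Ladd.
Proof. by move=> x y; rewrite -[x]lclK -[y]lclK !LE; apply/lclP; constructor. Qed.
Lemma Ladd0 : left_id (lcl LZero) Ladd.
Proof. by move=> x; rewrite -[x]lclK !LE; apply/lclP; constructor. Qed.
Lemma LaddN : left_inverse (lcl LZero) Lopp Ladd.
Proof. by move=> x; rewrite -[x]lclK !LE; apply/lclP; constructor. Qed.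

HB.instance Definition _ := GRing.isZmodule.Build L LaddA LaddC Ladd0 LaddN.

Lemma lcl0 : lcl LZero = 0. Proof. by []. Qed.
Lemma lclD t u : lcl (LAdd t u) = lcl t + lcl u. Proof. by rewrite -LaddE. Qed.
Lemma lclN t : lcl (LOpp t) = - lcl t. Proof. by rewrite -LoppE. Qed.

Lemma lcl_sum s : lcl (lsum s) = \sum_(t <- s) lcl t.
Proof. by elim: s => [|t s IH]; rewrite ?big_nil ?big_cons //= lclD IH. Qed.

Lemma LmulA : associative Lmul.
Proof.
by move=> x y z; rewrite -[x]lclK -[y]lclK -[z]lclK !LE; apply/lclP; constructor.
Qed.
Lemma LmulDl : left_distributive Lmul +%R.
Proof.
move=> x y z; rewrite -[x]lclK -[y]lclK -[z]lclK; move: (repr x) (repr y) (repr z) => t u w.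
by rewrite -[lcl t + _]lclD !LmulE -[RHS]lclD; apply/lclP; constructor.
Qed.
Lemma LmulDr : right_distributive Lmul +%R.
Proof.
move=> x y z; rewrite -[x]lclK -[y]lclK -[z]lclK; move: (repr x) (repr y) (repr z) => t u w.
by rewrite -[lcl u + _]lclD !LmulE -[RHS]lclD; apply/lclP; constructor.
Qed.

Lemma Lmul0 x : Lmul 0 x = 0.
Proof. by apply: (@morphD0 L L (Lmul^~ x)) => y z; rewrite LmulDl. Qed.
Lemma Lmulr0 x : Lmul x 0 = 0.
Proof. by apply: (@morphD0 L L (Lmul x)) => y z; rewrite LmulDr. Qed.
Lemma LmulN x y : Lmul x (- y) = - Lmul x y.
Proof. by rewrite -sub0r (@morphDB L L (Lmul x)) ?Lmulr0 ?sub0r // => u v; rewrite LmulDr. Qed.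
Lemma LmulNl x y : Lmul (- x) y = - Lmul x y.
Proof. by rewrite -sub0r (@morphDB L L (Lmul^~ y)) ?Lmul0 ?sub0r // => u v; rewrite LmulDl. Qed.

Lemma Lscalel c x y : Lscale c (Lmul x y) = Lmul (Lscale c x) y.
Proof. by rewrite -[x]lclK -[y]lclK !LE; apply/lclP; constructor. Qed.
Lemma Lscaler c x y : Lscale c (Lmul x y) = Lmul x (Lscale c y).
Proof. by rewrite -[x]lclK -[y]lclK !LE; apply/lclP; constructor. Qed.

Definition Lv (v : vert E) : L := lcl (LVert v).
Definition Le (e : edge E) : L := lcl (LEdge e).
Definition Lg (e : edge E) : L := lcl (LGhost e).

Let vM v w : Lmul (Lv v) (Lv w) = if v == w then Lv v else 0.
Proof. by rewrite LmulE (iffRL (lclP _ _) (lc_vert k v w)); case: (v == w). Qed.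
Let srcM e : Lmul (Lv (src e)) (Le e) = Le e.
Proof. by rewrite LE; apply/lclP; constructor. Qed.
Let rngM e : Lmul (Le e) (Lv (rng e)) = Le e.
Proof. by rewrite LE; apply/lclP; constructor. Qed.
Let rngVM e : Lmul (Lv (rng e)) (Lg e) = Lg e.
Proof. by rewrite LE; apply/lclP; constructor. Qed.
Let srcVM e : Lmul (Lg e) (Lv (src e)) = Lg e.
Proof. by rewrite LE; apply/lclP; constructor. Qed.

Let oneE : Lone = \sum_v Lv v.
Proof. by rewrite /Lone lcl_sum big_map big_enum. Qed.

Let LmulDlS (I : Type) (s : seq I) (F : I -> L) x :
  Lmul (\sum_(i <- s) F i) x = \sum_(i <- s) Lmul (F i) x.
Proof. by elim: s => [|i s IH]; rewrite ?big_nil ?Lmul0 // !big_cons LmulDl IH. Qed.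

Let LmulDrS (I : Type) (s : seq I) (F : I -> L) x :
  Lmul x (\sum_(i <- s) F i) = \sum_(i <- s) Lmul x (F i).
Proof. by elim: s => [|i s IH]; rewrite ?big_nil ?Lmulr0 // !big_cons LmulDr IH. Qed.

Let one_v v : Lmul Lone (Lv v) = Lv v.
Proof.
rewrite oneE LmulDlS (bigD1 v) //= vM eqxx big1 ?addr0 // => w wv.
by rewrite vM (negPf wv).
Qed.

Let v_one v : Lmul (Lv v) Lone = Lv v.
Proof.
rewrite oneE LmulDrS (bigD1 v) //= vM eqxx big1 ?addr0 // => w wv.
by rewrite vM eq_sym (negPf wv).
Qed.

Lemma leavitt_ind (P : L -> Prop) :
  (forall v, P (Lv v)) -> (forall e, P (Le e)) -> (forall e, P (Lg e)) -> P 0 ->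
  (forall x y, P x -> P y -> P (x + y)) -> (forall x, P x -> P (- x)) ->
  (forall c x, P x -> P (Lscale c x)) -> (forall x y, P x -> P y -> P (Lmul x y)) ->
  forall x, P x.
Proof.
move=> Pv Pe Pg P0 PD PN PZ PM x; rewrite -[x]lclK.
elim: (repr x) => [v|e|e||t ht u hu|t ht|c t ht|t ht u hu].
- exact: Pv.
- exact: Pe.
- exact: Pg.
- exact: P0.
- by rewrite lclD; apply: PD.
- by rewrite lclN; apply: PN.
- by rewrite -LscaleE; apply: PZ.
- by rewrite -LmulE; apply: PM.
Qed.

Lemma Lmul1 : left_id Lone Lmul.
Proof.
elim/leavitt_ind => [v|e|e||x y hx hy|x hx|c x hx|x y hx hy].
- exact: one_v.
- by rewrite -srcM LmulA one_v.
- by rewrite -rngVM LmulA one_v.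
- exact: Lmulr0.
- by rewrite LmulDr hx hy.
- by rewrite LmulN hx.
- by rewrite -Lscaler hx.
- by rewrite LmulA hx.
Qed.

Lemma Lmulr1 : right_id Lone Lmul.
Proof.
elim/leavitt_ind => [v|e|e||x y hx hy|x hx|c x hx|x y hx hy].
- exact: v_one.
- by rewrite -rngM -LmulA v_one.
- by rewrite -srcVM -LmulA v_one.
- exact: Lmul0.
- by rewrite LmulDl hx hy.
- by rewrite LmulNl hx.
- by rewrite -Lscalel hx.
- by rewrite -LmulA hy.
Qed.

HB.instance Definition _ := GRing.Zmodule_isPzRing.Build L LmulA Lmul1 Lmulr1 LmulDl LmulDr.

Lemma LscaleA c d x : Lscale c (Lscale d x) = Lscale (c * d) x.
Proof. by rewrite -[x]lclK !LE; apply/lclP; constructor. Qed.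
Lemma Lscale1 : left_id 1 Lscale.
Proof. by move=> x; rewrite -[x]lclK !LE; apply/lclP; constructor. Qed.
Lemma LscaleDr : right_distributive Lscale +%R.
Proof.
move=> c x y; rewrite -[x]lclK -[y]lclK; move: (repr x) (repr y) => t u.
by rewrite -[lcl t + _]lclD !LscaleE -[RHS]lclD; apply/lclP; constructor.
Qed.
Lemma LscaleDl x : {morph Lscale^~ x : c d / c + d}.
Proof.
move=> c d; rewrite -[x]lclK; move: (repr x) => t.
by rewrite !LscaleE -[RHS]lclD; apply/lclP; constructor.
Qed.

HB.instance Definition _ :=
  GRing.Zmodule_isLmodule.Build k L LscaleA Lscale1 LscaleDr LscaleDl.

Lemma LscaleAl c (x y : L) : c *: (x * y) = (c *: x) * y.
Proof. exact: Lscalel. Qed.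
Lemma LscaleAr c (x y : L) : c *: (x * y) = x * (c *: y).
Proof. exact: Lscaler. Qed.

Lemma lclZ c t : lcl (LScale c t) = c *: lcl t. Proof. by rewrite -LscaleE. Qed.
Lemma lclM t u : lcl (LMul t u) = lcl t * lcl u. Proof. by rewrite -LmulE. Qed.

Lemma Lv_mul v w : Lv v * Lv w = if v == w then Lv v else 0.
Proof. exact: vM. Qed.
Lemma Lsrc_mul e : Lv (src e) * Le e = Le e.
Proof. exact: srcM. Qed.
Lemma Lmul_rng e : Le e * Lv (rng e) = Le e.
Proof. exact: rngM. Qed.
Lemma Lrng_mul e : Lv (rng e) * Lg e = Lg e.
Proof. exact: rngVM. Qed.
Lemma Lmul_src e : Lg e * Lv (src e) = Lg e.
Proof. exact: srcVM. Qed.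
Lemma L_CK1 e f : Lg e * Le f = if e == f then Lv (rng e) else 0.
Proof. by rewrite [LHS]LmulE (iffRL (lclP _ _) (lc_CK1 k e f)); case: (e == f). Qed.
Lemma L_CK2 v : Lv v = \sum_(e | src e == v) Le e * Lg e.
Proof.
rewrite [LHS](iffRL (lclP _ _) (lc_CK2 k v)).
rewrite lcl_sum big_map big_filter big_enum_cond /=.
apply: eq_bigr => e _; exact/esym/LmulE.
Qed.
Lemma L_one : 1 = \sum_v Lv v.
Proof. exact: oneE. Qed.

End LeavittAlgebra.

Inductive kspan (k : fieldType) (V : lmodType k) (G : V -> Prop) : V -> Prop :=
| kspan0 : kspan G 0
| kspanD c x y : G x -> kspan G y -> kspan G (c *: x + y).

Section LeavittGrading.
Context (k : fieldType) (E : digraph).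
Notation L := (leavitt_sort k E).

(* A path in E is a pair (v, p) with v its source and p its sequence of edges. *)
Fixpoint is_path (v : vert E) (p : seq (edge E)) : bool :=
  if p is e :: p' then (src e == v) && is_path (rng e) p' else true.

Fixpoint path_elt (v : vert E) (p : seq (edge E)) : L :=
  if p is e :: p' then Le k e * path_elt (rng e) p' else Lv k v.

Fixpoint ghost_elt (v : vert E) (p : seq (edge E)) : L :=
  if p is e :: p' then ghost_elt (rng e) p' * Lg k e else Lv k v.

Definition leavitt_mono (n : int) (x : L) : Prop := exists v p w q,
  [/\ is_path v p, is_path w q, (size p)%:Z - (size q)%:Z = n
    & x = path_elt v p * ghost_elt w q].

Definition leavitt_comp (n : int) : L -> Prop := kspan (leavitt_mono n).

Let scaleAl := @LscaleAl k E.
Let scaleAr := @LscaleAr k E.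

Lemma leavitt_compD n x y : leavitt_comp n x -> leavitt_comp n y -> leavitt_comp n (x + y).
Proof.
by move=> hx hy; elim: hx => [|c a b ha _ ih]; rewrite ?add0r // -addrA; apply: kspanD.
Qed.

Lemma leavitt_compZ n c x : leavitt_comp n x -> leavitt_comp n (c *: x).
Proof.
elim=> [|d a b ha _ ih]; first by rewrite scaler0; exact: kspan0.
by rewrite scalerDr scalerA; apply: kspanD.
Qed.

Lemma leavitt_compB n x y : leavitt_comp n x -> leavitt_comp n y -> leavitt_comp n (x - y).
Proof. by move=> hx hy; apply: leavitt_compD => //; rewrite -scaleN1r; exact: leavitt_compZ. Qed.

Lemma leavitt_comp_mono n x : leavitt_mono n x -> leavitt_comp n x.
Proof. by move=> h; rewrite -[x]scale1r -[_ *: x]addr0; apply: kspanD => //; exact: kspan0. Qed.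

Lemma leavitt_comp_v v : leavitt_comp 0 (Lv k v).
Proof.
by apply: leavitt_comp_mono; exists v, [::], v, [::]; split; rewrite ?subrr //= Lv_mul eqxx.
Qed.

Lemma leavitt_comp_e e : leavitt_comp 1 (Le k e).
Proof.
apply: leavitt_comp_mono; exists (src e), [:: e], (rng e), [::]; split=> //=.
  by rewrite eqxx.
by rewrite -mulrA Lv_mul eqxx Lmul_rng.
Qed.

Lemma leavitt_comp_g e : leavitt_comp (-1) (Lg k e).
Proof.
apply: leavitt_comp_mono; exists (rng e), [::], (src e), [:: e]; split=> //=.
  by rewrite eqxx.
by rewrite mulrA Lv_mul eqxx Lrng_mul.
Qed.

Lemma v_path w v p : is_path v p ->
  Lv k w * path_elt v p = if w == v then path_elt v p else 0.
Proof.
case: p => [_|e p /= /andP[/eqP <- _]]; first by rewrite /= Lv_mul; case: eqP => // ->.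
by rewrite -[in LHS]Lsrc_mul !mulrA Lv_mul; case: eqP => [->|]; rewrite ?Lsrc_mul ?mul0r.
Qed.

Lemma ghost_v w v p : is_path v p ->
  ghost_elt v p * Lv k w = if w == v then ghost_elt v p else 0.
Proof.
case: p => [_|e p /= /andP[/eqP <- _]].
  by rewrite /= Lv_mul eq_sym; case: eqP => // ->.
rewrite -[in LHS]Lmul_src -!mulrA Lv_mul eq_sym; case: eqP => _; first by rewrite Lmul_src.
by rewrite !mulr0.
Qed.

Lemma path_path v p w q : is_path v p -> is_path w q ->
  path_elt v p * path_elt w q = 0 \/
  is_path v (p ++ q) /\ path_elt v p * path_elt w q = path_elt v (p ++ q).
Proof.
elim: p v => [|e p ih] v /=.
  by move=> _ hq; rewrite v_path //; case: eqP => [->|]; [right | left].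
move=> /andP[/eqP <- hp] hq; rewrite -mulrA eqxx /=.
by case: (ih _ hp hq) => [->|[h ->]]; [left; rewrite mulr0 | right].
Qed.

Lemma ghost_ghost v p w q : is_path v p -> is_path w q ->
  ghost_elt w q * ghost_elt v p = 0 \/
  is_path v (p ++ q) /\ ghost_elt w q * ghost_elt v p = ghost_elt v (p ++ q).
Proof.
elim: p v => [|e p ih] v /=.
  by move=> _ hq; rewrite ghost_v //; case: eqP => [->|]; [right | left].
move=> /andP[/eqP <- hp] hq; rewrite mulrA eqxx /=.
by case: (ih _ hp hq) => [->|[h ->]]; [left; rewrite mul0r | right].
Qed.

Lemma ghost_path w q v p : is_path w q -> is_path v p ->
  [\/ ghost_elt w q * path_elt v p = 0,
      exists u r, [/\ is_path u r, size p = (size q + size r)%N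
        & ghost_elt w q * path_elt v p = path_elt u r]
    | exists u r, [/\ is_path u r, size q = (size p + size r)%N
        & ghost_elt w q * path_elt v p = ghost_elt u r]].
Proof.
elim: q w v p => [|e q ih] w v p hq hp.
  rewrite /= v_path //; case: eqP => [_|]; last by constructor 1.
  by constructor 2; exists v, p.
case: p hp => [|f p] hp.
  rewrite ghost_v //; case: eqP => [_|]; last by constructor 1.
  by constructor 3; exists w, (e :: q).
case/andP: hq => /eqP <- hq; case/andP: hp => /eqP <- hp /=.
rewrite -mulrA [Lg _ _ * _]mulrA L_CK1.
case: eqP hp => [<-|] hp; last by rewrite mul0r mulr0; constructor 1.
rewrite v_path // eqxx.
case: (ih _ _ _ hq hp) => [->|[u [r [hr sr ->]]]|[u [r [hr sr ->]]]]; first by constructor 1.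
- by constructor 2; exists u, r; rewrite sr.
- by constructor 3; exists u, r; rewrite sr.
Qed.

Lemma leavitt_monoM m n x y : leavitt_mono m x -> leavitt_mono n y -> leavitt_comp (m + n) (x * y).
Proof.
move=> [v [p [w [q [hp hq <- ->]]]]] [v' [p' [w' [q' [hp' hq' <- ->]]]]].
rewrite -mulrA [ghost_elt w q * _]mulrA.
case: (ghost_path hq hp') => [->|[u [r [hr sr ->]]]|[u [r [hr sr ->]]]].
- by rewrite mul0r mulr0; exact: kspan0.
- rewrite mulrA; case: (path_path hp hr) => [->|[h ->]]; first by rewrite mul0r; exact: kspan0.
  apply: leavitt_comp_mono; exists v, (p ++ r), w', q'; split=> //.
  by rewrite sr size_cat !PoszD; ring.
- case: (ghost_ghost hq' hr) => [->|[h ->]]; first by rewrite mulr0; exact: kspan0.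
  apply: leavitt_comp_mono; exists v, p, w', (q' ++ r); split=> //.
  by rewrite sr size_cat !PoszD; ring.
Qed.

Lemma leavitt_compM m n x y : leavitt_comp m x -> leavitt_comp n y -> leavitt_comp (m + n) (x * y).
Proof.
move=> hx hy; elim: hx => [|c a b ha _ ih]; first by rewrite mul0r; exact: kspan0.
rewrite mulrDl; apply: leavitt_compD => //; rewrite -scaleAl; apply: leavitt_compZ.
elim: hy => [|d a' b' ha' _ ih']; first by rewrite mulr0; exact: kspan0.
by rewrite mulrDr; apply: leavitt_compD => //; rewrite -scaleAr; apply/leavitt_compZ/leavitt_monoM.
Qed.

Let hsum (x : L) := exists s : seq (int * L),
  (forall p, p \in s -> leavitt_comp p.1 p.2) /\ x = \sum_(p <- s) p.2.

Let hsum1 n x : leavitt_comp n x -> hsum x.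
Proof.
by move=> h; exists [:: (n, x)]; split; [move=> p; rewrite inE => /eqP -> | rewrite big_seq1].
Qed.

Let hsumD x y : hsum x -> hsum y -> hsum (x + y).
Proof.
move=> [s [hs ->]] [t [ht ->]]; exists (s ++ t); split; last by rewrite big_cat.
by move=> p; rewrite mem_cat => /orP[/hs|/ht].
Qed.

Let hsum_big (I : eqType) (s : seq I) (F : I -> L) :
  (forall i, i \in s -> hsum (F i)) -> hsum (\sum_(i <- s) F i).
Proof.
elim: s => [_|i s ih h]; first by rewrite big_nil; apply: (@hsum1 0); exact: kspan0.
rewrite big_cons; apply: hsumD; first by apply: h; rewrite mem_head.
by apply: ih => j js; apply: h; rewrite inE js orbT.
Qed.

Let hsumZ c x : hsum x -> hsum (c *: x).
Proof.
move=> [s [hs ->]]; rewrite scaler_sumr; apply: hsum_big => p ps.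
by apply: (@hsum1 p.1); apply: leavitt_compZ; exact: hs.
Qed.

Let hsumM x y : hsum x -> hsum y -> hsum (x * y).
Proof.
move=> [s [hs ->]] [t [ht ->]]; rewrite mulr_suml; apply: hsum_big => p ps.
rewrite mulr_sumr; apply: hsum_big => q qt.
by apply: (@hsum1 (p.1 + q.1)); apply: leavitt_compM; [exact: hs | exact: ht].
Qed.

Lemma leavitt_hsum x : hsum x.
Proof.
elim/leavitt_ind: x => [v|e|e||x y hx hy|x hx|c x hx|x y hx hy].
- exact: hsum1 (leavitt_comp_v v).
- exact: hsum1 (leavitt_comp_e e).
- exact: hsum1 (leavitt_comp_g e).
- by apply: (@hsum1 0); exact: kspan0.
- exact: hsumD.
- by rewrite -scaleN1r; exact: hsumZ.
- exact: hsumZ.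
- exact: hsumM.
Qed.

(* L acts on functions int -> L, an element x of degree d by
   f |-> (n |-> x * f (n - d)); hence the components are independent. *)
Fixpoint tact (t : lterm k E) (f : int -> L) (n : int) : L :=
  match t with
  | LVert v => Lv k v * f n
  | LEdge e => Le k e * f (n - 1)
  | LGhost e => Lg k e * f (n + 1)
  | LZero => 0
  | LAdd t u => tact t f n + tact u f n
  | LOpp t => - tact t f n
  | LScale c t => c *: tact t f n
  | LMul t u => tact t (tact u f) n
  end.

Let tactD t f g : tact t (fun n => f n + g n) = (fun n => tact t f n + tact t g n).
Proof.
elim: t f g => [v|e|e||t ht u hu|t ht|c t ht|t ht u hu] f g; apply/funext => n /=.
- by rewrite mulrDr.
- by rewrite mulrDr.
- by rewrite mulrDr.
- by rewrite addr0.
- by rewrite ht hu addrACA.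
- by rewrite ht opprD.
- by rewrite ht scalerDr.
- by rewrite hu ht.
Qed.

Let tactZ c t f : tact t (fun n => c *: f n) = (fun n => c *: tact t f n).
Proof.
elim: t f => [v|e|e||t ht u hu|t ht|d t ht|t ht u hu] f; apply/funext => n /=.
- by rewrite scaleAr.
- by rewrite scaleAr.
- by rewrite scaleAr.
- by rewrite scaler0.
- by rewrite ht hu scalerDr.
- by rewrite ht scalerN.
- by rewrite ht !scalerA mulrC.
- by rewrite hu ht.
Qed.

Let tact_sum s f n : tact (lsum s) f n = \sum_(t <- s) tact t f n.
Proof. by elim: s => [|t s ih]; rewrite ?big_nil ?big_cons //= ih. Qed.

Lemma tact_cong t u : lcong t u -> tact t = tact u.
Proof.
elim=> /=.
- by [].
- by move=> ? ? _ ->.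
- by move=> ? ? ? _ -> _ ->.
- by move=> ? ? ? ? _ h _ h'; apply/funext => f; apply/funext => n /=; rewrite h h'.
- by move=> ? ? _ h; apply/funext => f; apply/funext => n /=; rewrite h.
- by move=> ? ? ? _ h; apply/funext => f; apply/funext => n /=; rewrite h.
- by move=> ? ? ? ? _ h _ h'; apply/funext => f; apply/funext => n /=; rewrite h h'.
- by move=> *; apply/funext => f; apply/funext => n /=; rewrite addrA.
- by move=> *; apply/funext => f; apply/funext => n /=; rewrite addrC.
- by move=> *; apply/funext => f; apply/funext => n /=; rewrite add0r.
- by move=> *; apply/funext => f; apply/funext => n /=; rewrite addNr.
- by move=> *; apply/funext => f; apply/funext => n /=; rewrite scalerA.
- by move=> *; apply/funext => f; apply/funext => n /=; rewrite scale1r.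
- by move=> *; apply/funext => f; apply/funext => n /=; rewrite scalerDr.
- by move=> *; apply/funext => f; apply/funext => n /=; rewrite scalerDl.
- by [].
- by [].
- by move=> *; apply/funext => f; apply/funext => n /=; rewrite tactD.
- by [].
- by move=> *; apply/funext => f; apply/funext => n /=; rewrite tactZ.
- move=> v v'; apply/funext => f; apply/funext => n /=; rewrite mulrA Lv_mul.
  by case: eqP => //=; rewrite mul0r.
- by move=> *; apply/funext => f; apply/funext => n /=; rewrite mulrA Lsrc_mul.
- by move=> *; apply/funext => f; apply/funext => n /=; rewrite mulrA Lmul_rng.
- by move=> *; apply/funext => f; apply/funext => n /=; rewrite mulrA Lrng_mul.
- by move=> *; apply/funext => f; apply/funext => n /=; rewrite mulrA Lmul_src.
- move=> e g; apply/funext => f; apply/funext => n /=; rewrite mulrA L_CK1 addrK.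
  by case: eqP => //=; rewrite mul0r.
- move=> v; apply/funext => f; apply/funext => n /=; rewrite tact_sum.
  rewrite big_map big_filter big_enum_cond /= L_CK2 mulr_suml.
  by apply: eq_bigr => e _; rewrite -mulrA subrK.
Qed.

Let act (x : L) := tact (repr x).

Let actE t : act (lcl t) = tact t.
Proof. by apply: tact_cong; exact: repr_lcl. Qed.

Let act0 f n : act 0 f n = 0.
Proof. by rewrite -lcl0 actE. Qed.

Let actD x y f n : act (x + y) f n = act x f n + act y f n.
Proof. by rewrite -[x in LHS]lclK -[y in LHS]lclK -lclD actE. Qed.

Let actZ c x f n : act (c *: x) f n = c *: act x f n.
Proof. by rewrite -[x in LHS]lclK -lclZ actE. Qed.

Let actM x y f : act (x * y) f = act x (act y f).
Proof. by rewrite -[x in LHS]lclK -[y in LHS]lclK -lclM actE. Qed.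

Let act_mono p q v w f n : is_path v p -> is_path w q ->
  act (path_elt v p * ghost_elt w q) f n =
  path_elt v p * ghost_elt w q * f (n - ((size p)%:Z - (size q)%:Z)).
Proof.
have actg : forall q w g m, act (ghost_elt w q) g m = ghost_elt w q * g (m + (size q)%:Z).
  elim=> [|e r ih] u g m /=; first by rewrite actE addr0.
  by rewrite actM ih actE /= mulrA -addrA [_ + 1]addrC -intS.
rewrite actM; elim: p v n => [|e p ih] v n /=.
  by rewrite actE /= actg mulrA sub0r opprK.
move=> /andP[_ hp] hq; rewrite actM actE /= ih // !mulrA intS.
by congr (_ * f _); ring.
Qed.

Lemma act_comp d x f n : leavitt_comp d x -> act x f n = x * f (n - d).
Proof.
elim=> [|c _ y [v [p [w [q [hp hq <- ->]]]]] _ ih]; first by rewrite act0 mul0r.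
by rewrite actD actZ act_mono // ih mulrDl scaleAl.
Qed.

Lemma leavitt_grading : is_grading leavitt_comp.
Proof.
split.
- by move=> i; exact: kspan0.
- exact: leavitt_compB.
- exact: leavitt_hsum.
move=> s y us hy sy0 i is_.
pose delta (n : int) : L := if n == 0 then 1 else 0.
have: act (\sum_(j <- s) y j) delta i = 0 by rewrite sy0 act0.
have -> : act (\sum_(j <- s) y j) delta i = \sum_(j <- s) act (y j) delta i.
  by elim: (s) => [|j t ih]; rewrite ?big_nil ?act0 // !big_cons actD ih.
rewrite (bigD1_seq i) //= big1 ?addr0 => [|j ji].
  by rewrite (act_comp _ _ (hy i)) /delta subrr eqxx mulr1.
by rewrite (act_comp _ _ (hy j)) /delta subr_eq0 eq_sym (negPf ji) mulr0.
Qed.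

Definition leavitt : gradedRing :=
  @GradedRing L leavitt_comp leavitt_grading leavitt_compM.

End LeavittGrading.

Record category := Category {
  obj :> Type;
  hom : obj -> obj -> Type;
  idm : forall a, hom a a;
  compm : forall a b c, hom b c -> hom a b -> hom a c;
  compm1 : forall a b (f : hom a b), compm f (idm a) = f;
  comp1m : forall a b (f : hom a b), compm (idm b) f = f;
  compmA : forall a b c d (h : hom c d) (g : hom b c) (f : hom a b),
    compm h (compm g f) = compm (compm h g) f
}.
Arguments hom {C} : rename.
Arguments idm {C} : rename.
Arguments compm {C a b c} : rename.

Record functor (C D : category) := Functor {
  fobj :> C -> D;
  fmap : forall a b, hom a b -> hom (fobj a) (fobj b);
  fmap1 : forall a, fmap (idm a) = idm (fobj a);
  fmapM : forall a b c (g : hom b c) (f : hom a b),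
    fmap (compm g f) = compm (fmap g) (fmap f)
}.
Arguments fmap {C D} F {a b} : rename.

Definition fun_id (C : category) : functor C C :=
  @Functor C C (fun a => a) (fun _ _ f => f) (fun _ => erefl) (fun _ _ _ _ _ => erefl).

Section FunctorComp.
Context (C D E : category) (G : functor D E) (F : functor C D).

Lemma fun_comp1 (a : C) : fmap G (fmap F (idm a)) = idm (G (F a)).
Proof. by rewrite !fmap1. Qed.

Lemma fun_compM (a b c : C) (g : hom b c) (f : hom a b) :
  fmap G (fmap F (compm g f)) = compm (fmap G (fmap F g)) (fmap G (fmap F f)).
Proof. by rewrite !fmapM. Qed.

Definition fun_comp : functor C E :=
  @Functor C E (fun a => G (F a)) (fun _ _ f => fmap G (fmap F f)) fun_comp1 fun_compM.

End FunctorComp.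

Definition is_iso (C : category) (a b : C) (f : hom a b) :=
  exists g : hom b a, compm g f = idm a /\ compm f g = idm b.

Definition nat_isomorphic (C D : category) (F G : functor C D) :=
  exists eta : forall a, hom (F a) (G a),
    (forall a b (f : hom a b), compm (eta b) (fmap F f) = compm (fmap G f) (eta a)) /\
    (forall a, is_iso (eta a)).

Definition is_equivalence (C D : category) (F : functor C D) :=
  exists G : functor D C,
    nat_isomorphic (fun_comp G F) (fun_id C) /\ nat_isomorphic (fun_comp F G) (fun_id D).

Lemma linear_ext (R : pzRingType) (U V : lmodType R) (f g : {linear U -> V}) : f =1 g -> f = g.
Proof.
case: f g => [f [[cf1] [cf2]]] [g [[cg1] [cg2]]] /= /funext fg; subst g.
by rewrite (Prop_irrelevance cf1 cg1) (Prop_irrelevance cf2 cg2).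
Qed.

(* Right R-modules are encoded as left modules over the converse ring R^c. *)
Section ModCategory.
Context (R : pzRingType).
Implicit Types M N P Q : lmodType R^c.

Definition mod_id M : {linear M -> M} := idfun.
Definition mod_comp M N P (g : {linear N -> P}) (f : {linear M -> N}) : {linear M -> P} := g \o f.

Lemma mod_comp1 M N (f : {linear M -> N}) : mod_comp f (mod_id M) = f.
Proof. exact: linear_ext. Qed.
Lemma mod_1comp M N (f : {linear M -> N}) : mod_comp (mod_id N) f = f.
Proof. exact: linear_ext. Qed.
Lemma mod_compA M N P Q (h : {linear P -> Q}) (g : {linear N -> P}) (f : {linear M -> N}) :
  mod_comp h (mod_comp g f) = mod_comp (mod_comp h g) f.
Proof. exact: linear_ext. Qed.

Definition Mod : category :=
  @Category (lmodType R^c) (fun M N => {linear M -> N}) mod_id mod_comp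
    mod_comp1 mod_1comp mod_compA.

End ModCategory.

Record grmod (R : gradedRing) := Grmod {
  gm_mod :> lmodType R^c;
  gm_comp : int -> gm_mod -> Prop;
  gm_grading : is_grading gm_comp;
  gm_act : forall i j (x : gm_mod) (a : R),
    gm_comp i x -> gr_comp j a -> gm_comp (i + j) ((a : R^c) *: x)
}.

Section GrCategory.
Context (R : gradedRing).
Implicit Types M N P Q : grmod R.

Record grhom M N := Grhom {
  grh_lin :> {linear M -> N};
  grh_deg : forall i x, gm_comp i x -> gm_comp i (grh_lin x)
}.

Lemma grhom_ext M N (f g : grhom M N) : grh_lin f = grh_lin g -> f = g.
Proof.
by case: f g => [f hf] [g hg] /= fg; subst g; rewrite (Prop_irrelevance hf hg).
Qed.

Definition gr_id M : grhom M M := @Grhom M M (mod_id M) (fun _ _ h => h).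

Definition gr_mcomp M N P (g : grhom N P) (f : grhom M N) : grhom M P :=
  @Grhom M P (mod_comp g f) (fun i x h => grh_deg g (grh_deg f h)).

Lemma gr_comp1 M N (f : grhom M N) : gr_mcomp f (gr_id M) = f.
Proof. exact/grhom_ext/mod_comp1. Qed.
Lemma gr_1comp M N (f : grhom M N) : gr_mcomp (gr_id N) f = f.
Proof. exact/grhom_ext/mod_1comp. Qed.
Lemma gr_compA M N P Q (h : grhom P Q) (g : grhom N P) (f : grhom M N) :
  gr_mcomp h (gr_mcomp g f) = gr_mcomp (gr_mcomp h g) f.
Proof. exact/grhom_ext/mod_compA. Qed.

Definition Gr : category :=
  @Category (grmod R) grhom gr_id gr_mcomp gr_comp1 gr_1comp gr_compA.

Definition forget : functor Gr (Mod R) :=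
  @Functor Gr (Mod R) (fun M : grmod R => gm_mod M) (fun M N (f : grhom M N) => grh_lin f)
    (fun _ => erefl) (fun _ _ _ _ _ => erefl).

Section Suspension.
Context (gamma : int).

Lemma susp_grading M : is_grading (fun g => @gm_comp R M (gamma + g)).
Proof.
case: (gm_grading M) => C0 CB Cs Cf; split=> [i|i x y|x|s y us hy sy0 i is_].
- exact: C0.
- exact: CB.
- have [s [hs ->]] := Cs x; exists [seq (p.1 - gamma, p.2) | p <- s].
  split; last by rewrite big_map.
  by move=> _ /mapP[p ps ->] /=; rewrite addrC subrK; exact: hs.
- have := Cf [seq gamma + j | j <- s] (fun j => y (j - gamma)).
  have yE j : y (gamma + j - gamma) = y j by congr y; ring.
  move=> /(_ _ _ _ (gamma + i)); rewrite yE; apply.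
  + by rewrite map_inj_uniq //; exact: addrI.
  + by move=> j; have := hy (j - gamma); rewrite addrC subrK.
  + by rewrite big_map -[RHS]sy0; apply: eq_bigr => j _; exact: yE.
  + exact: map_f.
Qed.

Lemma susp_act M i j (x : M) (a : R) :
  gm_comp (gamma + i) x -> gr_comp j a -> gm_comp (gamma + (i + j)) ((a : R^c) *: x).
Proof. by move=> hx ha; rewrite addrA; exact: gm_act. Qed.

Definition susp_mod M : grmod R :=
  @Grmod R (gm_mod M) (fun g => gm_comp (gamma + g)) (susp_grading M) (@susp_act M).

Definition susp_map M N (f : grhom M N) : grhom (susp_mod M) (susp_mod N) :=
  @Grhom (susp_mod M) (susp_mod N) (grh_lin f) (fun g x h => grh_deg f h).

Lemma susp_map1 M : susp_map (gr_id M) = gr_id (susp_mod M).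
Proof. exact: grhom_ext. Qed.

Lemma susp_mapM M N P (g : grhom N P) (f : grhom M N) :
  susp_map (gr_mcomp g f) = gr_mcomp (susp_map g) (susp_map f).
Proof. exact: grhom_ext. Qed.

Definition susp : functor Gr Gr := @Functor Gr Gr susp_mod susp_map susp_map1 susp_mapM.

End Suspension.
End GrCategory.

Definition graded_functor (R S : gradedRing) (Phi : functor (Gr R) (Gr S)) :=
  forall (M : Gr R) (gamma : int), susp S gamma (Phi M) = Phi (susp R gamma M).

Definition graded_functor_Mod (R S : gradedRing) (phi : functor (Mod R) (Mod S)) :=
  exists Phi : functor (Gr R) (Gr S),
    graded_functor Phi /\ fun_comp (forget S) Phi = fun_comp phi (forget R).

Definition geMod (R S : gradedRing) :=
  exists phi : functor (Mod R) (Mod S), graded_functor_Mod phi /\ is_equivalence phi.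

Definition geGr (R S : gradedRing) :=
  exists (Phi : functor (Gr R) (Gr S)) (Gamma : functor (Gr S) (Gr R)),
    [/\ graded_functor Phi, graded_functor Gamma,
        nat_isomorphic (fun_comp Gamma Phi) (fun_id (Gr R))
      & nat_isomorphic (fun_comp Phi Gamma) (fun_id (Gr S))].

(* The two conditions are equivalent by a theorem of Hazrat. *)
Definition graded_morita_equivalent (R S : gradedRing) := geMod R S \/ geGr R S.

(* Main.v *)
Require Import Defs.
From HB Require Import structures.
From mathcomp Require Import all_boot all_algebra.
From mathcomp Require Import boolp.
Set Implicit Arguments.
Unset Strict Implicit.
Unset Printing Implicit Defensive.

Import GRing.Theory.
Local Open Scope ring_scope.

(** Write [R], [S] for [kE0] of [E], [F]. A right module [V] over the Leavitt path
    algebra of [E] is the same as a right [R]-module for which the map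
    [V -> Hom_R(kE1, V)], [x |-> (y |-> x y)], is bijective: the relation
    [v = sum e e^*] says that it is injective, and the ghost edges, subject to
    [e^* e' = delta r(e)], provide preimages. In this description the ghost edges
    disappear, and a bimodule [N] with an isomorphism
    [sigma_N : kF1 ⊗ N -> N ⊗ kE1] transports module structures: [Hom_R(N, V)] is
    a right module over the Leavitt path algebra of [F], because
    [[
      Hom_S(kF1, Hom_R(N, V)) = Hom_R(kF1 ⊗ N, V) = Hom_R(N ⊗ kE1, V)
                              = Hom_R(N, Hom_R(kE1, V)) = Hom_R(N, V).
    ]]
    This gives a functor [Hom_R(N, -)] ([hom_functor]), and [M] gives a functor
    [Hom_S(M, -)] in the opposite direction. Their composite is
    [[
      Hom_S(M, Hom_R(N, V)) = Hom_R(M ⊗ N, V) = Hom_R((kE1)^n, V) = V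
    ]]
    by [omega_E] and an [n]-fold iteration of [V = Hom_R(kE1, V)]. The resulting
    bijection sends [x] to [u |-> (v |-> x omega_E(u ⊗ v))] ([unit_map]). It
    commutes with the vertices since [omega_E] is left linear, and it commutes with the
    edges precisely because [(omega_E ⊗ id) (sigma_M # sigma_N) = nu (id ⊗ omega_E)];
    an additive map that commutes with vertices and edges is linear over the whole
    algebra ([linear_of_edges]). By symmetry the other composite is isomorphic to the
    identity as well, so that [Hom_R(N, -)] is an equivalence.

    For graded [V], let a homomorphism have degree [i] when its values do. The
    suspension then commutes strictly with [Hom_R(N, -)]. That this is a grading, i.e.
    that only finitely many degrees occur in a homomorphism, requires [N] to be
    finitely generated as a right module. In a graph without sinks [R] is a direct
    summand of the left module [(kE1)^n] ([kE1pow_split]); hence [N] is a quotient of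
    [N ⊗ (kE1)^n = (N ⊗ M) ⊗ N = (kF1)^n ⊗ N], and only finitely many elements of [N]
    occur in generators of [N ⊗ M = (kF1)^n] ([fg_factor]). *)

(** * The vertex and edge spaces inside the Leavitt path algebra *)

Section Embedding.
Context (k : fieldType) (E : digraph).
Notation L := (leavitt_sort k E).
Notation R := (kE0 k E).
Notation X := (kE1 k E).

Lemma scaleLl c (x y : L) : (c *: x) * y = c *: (x * y).
Proof. by rewrite LscaleAl. Qed.
Lemma scaleLr c (x y : L) : x * (c *: y) = c *: (x * y).
Proof. by rewrite LscaleAr. Qed.

Definition vert_alg (a : R) : L := \sum_v (a : {ffun _ -> k}) v *: Lv k v.
Definition edge_alg (y : X) : L := \sum_e (y : {ffun _ -> k}) e *: Le k e.

Lemma vert_algD a b : vert_alg (a + b) = vert_alg a + vert_alg b.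
Proof. by rewrite -big_split; apply: eq_bigr => v _; rewrite ffunE scalerDl. Qed.

Lemma edge_algD x y : edge_alg (x + y) = edge_alg x + edge_alg y.
Proof. by rewrite -big_split; apply: eq_bigr => e _; rewrite ffunE scalerDl. Qed.

Lemma vert_alg1 : vert_alg 1 = 1.
Proof. by rewrite L_one; apply: eq_bigr => v _; rewrite ffunE scale1r. Qed.

Lemma vert_alg_vert v : vert_alg (kvert k v) = Lv k v.
Proof.
rewrite /vert_alg (bigD1 v) //= ffunE eqxx scale1r big1 ?addr0 // => w wv.
by rewrite ffunE (negPf wv) scale0r.
Qed.

Lemma edge_alg_edge e : edge_alg (kedge k e) = Le k e.
Proof.
rewrite /edge_alg (bigD1 e) //= ffunE eqxx scale1r big1 ?addr0 // => w wv.
by rewrite ffunE (negPf wv) scale0r.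
Qed.

Lemma vert_alg_scal c : vert_alg (kscal c) = c *: (1 : L).
Proof. by rewrite L_one scaler_sumr; apply: eq_bigr => v _; rewrite ffunE. Qed.

Lemma vert_algMv a v : vert_alg a * Lv k v = (a : {ffun _ -> k}) v *: Lv k v.
Proof.
rewrite /vert_alg mulr_suml (bigD1 v) //= scaleLl Lv_mul eqxx big1 ?addr0 // => w wv.
by rewrite scaleLl Lv_mul (negPf wv) scaler0.
Qed.

Lemma vert_algM a b : vert_alg (a * b) = vert_alg a * vert_alg b.
Proof.
rewrite [vert_alg b]/vert_alg mulr_sumr; apply: eq_bigr => v _.
by rewrite scaleLr vert_algMv scalerA ffunE mulrC.
Qed.

Lemma edge_alg_lact a y : edge_alg (lact a y) = vert_alg a * edge_alg y.
Proof.
rewrite [edge_alg y]/edge_alg mulr_sumr; apply: eq_bigr => e _.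
rewrite scaleLr -{2}(Lsrc_mul k e) mulrA vert_algMv scaleLl Lsrc_mul scalerA.
by rewrite ffunE mulrC.
Qed.

Lemma v_vert_alg a v : Lv k v * vert_alg a = (a : {ffun _ -> k}) v *: Lv k v.
Proof.
rewrite /vert_alg mulr_sumr (bigD1 v) //= scaleLr Lv_mul eqxx big1 ?addr0 // => w wv.
by rewrite scaleLr Lv_mul eq_sym (negPf wv) scaler0.
Qed.

Lemma edge_alg_ract y a : edge_alg (ract y a) = edge_alg y * vert_alg a.
Proof.
rewrite [edge_alg y]/edge_alg mulr_suml; apply: eq_bigr => e _.
by rewrite scaleLl -{2}(Lmul_rng k e) -mulrA v_vert_alg scaleLr Lmul_rng scalerA ffunE.
Qed.

Lemma kE0_sum_verts (a : R) : \sum_v kvert k v * kscal ((a : {ffun _ -> k}) v) = a.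
Proof.
apply/ffunP => v; rewrite sum_ffunE (bigD1 v) //= !ffunE eqxx mul1r big1 ?addr0 // => w wv.
by rewrite !ffunE eq_sym (negPf wv) mul0r.
Qed.

(** The product [e^* y] of the Leavitt path algebra, which lies in the vertex algebra:
    see [ghost_edge_alg]. *)
Definition edge_part (e : edge E) (y : X) : R :=
  [ffun v => (y : {ffun _ -> k}) e * (v == rng e)%:R : k].

Lemma edge_partE e y : edge_part e y = kscal ((y : {ffun _ -> k}) e) * kvert k (rng e).
Proof. by apply/ffunP => v; rewrite !ffunE. Qed.

Lemma edge_partD e x y : edge_part e (x + y) = edge_part e x + edge_part e y.
Proof. by apply/ffunP => v; rewrite !ffunE mulrDl. Qed.

Lemma edge_part_ract e y b : edge_part e (ract y b) = edge_part e y * b.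
Proof.
apply/ffunP => v; rewrite !ffunE; case: eqP => [->|_]; last by rewrite !mulr0 mul0r.
by rewrite !mulr1.
Qed.

Lemma edge_part_edge e f :
  edge_part e (kedge k f) = if f == e then kvert k (rng e) else 0.
Proof.
by rewrite eq_sym; apply/ffunP => v; rewrite !ffunE; case: eqP; rewrite ffunE ?mul1r ?mul0r.
Qed.

Lemma vert_alg_edge_part e y :
  vert_alg (edge_part e y) = (y : {ffun _ -> k}) e *: Lv k (rng e).
Proof. by rewrite edge_partE vert_algM vert_alg_scal vert_alg_vert scaleLl mul1r. Qed.

(** A ghost edge strips the first edge, so that left multiplication by [e^*] is the
    coordinate function of [e], with values in the vertex algebra. *)
Lemma ghost_edge_alg e y : Lg k e * edge_alg y = vert_alg (edge_part e y).
Proof.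
rewrite vert_alg_edge_part /edge_alg mulr_sumr (bigD1 e) //= scaleLr L_CK1 eqxx.
rewrite big1 ?addr0 // => f fe.
by rewrite scaleLr L_CK1 eq_sym (negPf fe) scaler0.
Qed.

Lemma ract_edge_part e y :
  ract (kedge k e : X) (edge_part e y) = [ffun f => (y : {ffun _ -> k}) e *+ (f == e)] :> X.
Proof.
apply/ffunP => f; rewrite !ffunE; case: (f =P e) => [->|]; last by rewrite mul0r.
by rewrite eqxx mulr1 mul1r.
Qed.

Lemma kE1_decomp (P : pred (edge E)) (y : X) :
  \sum_(e | P e) ract (kedge k e : X) (edge_part e y) =
  [ffun f => if P f then (y : {ffun _ -> k}) f else 0] :> X.
Proof.
under eq_bigr => e _ do rewrite ract_edge_part.
apply/ffunP => f; rewrite sum_ffunE ffunE.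
under eq_bigr => e _ do rewrite ffunE.
case: ifP => Pf.
  rewrite (bigD1 f) //= eqxx big1 ?addr0 // => e /andP[_ ef].
  by rewrite eq_sym (negPf ef).
by rewrite big1 // => e Pe; case: eqP => // fe; rewrite fe Pe in Pf.
Qed.

Lemma kE1_sum_edges (y : X) : \sum_e ract (kedge k e : X) (edge_part e y) = y.
Proof. by rewrite kE1_decomp; apply/ffunP => f; rewrite ffunE. Qed.

Lemma kE1_sum_edges_at v (y : X) :
  \sum_(e | src e == v) ract (kedge k e : X) (edge_part e y) = lact (kvert k v) y.
Proof.
rewrite kE1_decomp; apply/ffunP => f; rewrite !ffunE.
by case: eqP => _; rewrite ?mul1r ?mul0r.
Qed.

End Embedding.

(** * Right modules over the Leavitt path algebra *)

Notation right_mod k E := (lmodType (leavitt_sort k E)^c).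

Section RightModules.
Context (k : fieldType) (E : digraph).
Notation L := (leavitt_sort k E).
Notation R := (kE0 k E).
Notation X := (kE1 k E).

Definition vact (V : right_mod k E) (x : V) (a : R) : V := (vert_alg a : L^c) *: x.
Definition eact (V : right_mod k E) (x : V) (y : X) : V := (edge_alg y : L^c) *: x.

Section Theory.
Context (V : right_mod k E).
Implicit Types (x z : V) (a b : R) (y : X).

(** Right modules are left modules over the converse ring, which reverses products. *)
Lemma scaleLM (a b : L) x : ((b : L^c) *: ((a : L^c) *: x)) = ((a * b : L) : L^c) *: x.
Proof. by rewrite scalerA. Qed.

Lemma vactDl x z a : vact (x + z) a = vact x a + vact z a.
Proof. exact: scalerDr. Qed.
Lemma eactDl x z y : eact (x + z) y = eact x y + eact z y.
Proof. exact: scalerDr. Qed.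
Lemma eactDr x y y' : eact x (y + y') = eact x y + eact x y'.
Proof. by rewrite /eact edge_algD scalerDl. Qed.
Lemma eact_vact x a y : eact (vact x a) y = eact x (lact a y).
Proof. by rewrite /eact /vact scaleLM edge_alg_lact. Qed.
Lemma vact_eact x y b : vact (eact x y) b = eact x (ract y b).
Proof. by rewrite /eact /vact scaleLM edge_alg_ract. Qed.

(** This is the relation [v = sum e e^*]. *)
Lemma eact_inj x : (forall y, eact x y = 0) -> x = 0.
Proof.
move=> x0; rewrite -[x]scale1r -[1 : L^c]/(1 : L) L_one scaler_suml big1 // => v _.
rewrite L_CK2 scaler_suml big1 // => e _.
by rewrite -scaleLM -edge_alg_edge [X in _ *: X]x0 scaler0.
Qed.

Lemma eactB x z y : eact (x - z) y = eact x y - eact z y.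
Proof. exact: scalerBr. Qed.

Lemma eact_ext x z : (forall y, eact x y = eact z y) -> x = z.
Proof.
move=> xz; apply/eqP; rewrite -subr_eq0; apply/eqP/eact_inj => y.
by rewrite eactB xz subrr.
Qed.

End Theory.

Record right_linear (A : kalgebra k) (B : bimodule A R) (V : right_mod k E) (h : B -> V) : Prop :=
  RightLinear {
    rlD : forall x y, h (x + y) = h x + h y;
    rlM : forall x a, h (ract x a) = vact (h x) a
  }.

(** The ghost edges provide the preimage [sum h(e) e^*]. *)
Lemma eact_surj (V : right_mod k E) (h : X -> V) :
  right_linear h -> exists x, forall y, h y = eact x y.
Proof.
move=> [hD hM]; exists (\sum_e (Lg k e : L^c) *: h (kedge k e)) => y.
have h0 : h 0 = 0 by exact: morphD0.
rewrite -[in LHS](kE1_sum_edges y) (big_morph h hD h0) /eact scaler_sumr.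
by apply: eq_bigr => e _; rewrite hM scaleLM ghost_edge_alg.
Qed.

(** An additive map that respects vertices and edges respects the ghost edges,
    because an element is determined by its products with the edges. *)
Lemma linear_of_edges (V W : right_mod k E) (g : V -> W) :
  (forall x y, g (x + y) = g x + g y) ->
  (forall x a, g (vact x a) = vact (g x) a) ->
  (forall x y, g (eact x y) = eact (g x) y) ->
  forall (a : L^c) x, g (a *: x) = a *: g x.
Proof.
move=> gD gv ge a; elim/leavitt_ind: {a}(a : L) => [v|e|e||a b ha hb|a ha|c a ha|a b ha hb] x.
- by rewrite -vert_alg_vert; exact: gv.
- by rewrite -edge_alg_edge; exact: ge.
- by apply: eact_ext => y; rewrite -ge /eact !scaleLM ghost_edge_alg; exact: gv.
- by rewrite !scale0r (morphD0 gD).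
- by rewrite !scalerDl gD ha hb.
- rewrite !scaleNr -ha; apply/eqP; rewrite -subr_eq0 opprK; apply/eqP.
  by rewrite -gD addNr (morphD0 gD).
- have -> : Lscale c a = a * vert_alg (kscal c) by rewrite vert_alg_scal scaleLr mulr1.
  by rewrite -!scaleLM gv ha.
- by rewrite -[Lmul a b]/(a * b) -!scaleLM hb ha.
Qed.

End RightModules.

(** A right module over the Leavitt path algebra is the same as a right
    [kE0]-module [V] for which [x |-> (y |-> x y)] is a bijection of [V] onto the
    right linear maps from [kE1] to [V]: the ghost edge [e] then sends [x] to the
    element whose product with [y] is [x] times the [e]-part of [y]. *)
Record edge_module (k : fieldType) (E : digraph) := EdgeModule {
  em_sort :> zmodType;
  emv : em_sort -> kE0 k E -> em_sort;
  eme : em_sort -> kE1 k E -> em_sort;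
  emvDl : forall x z a, emv (x + z) a = emv x a + emv z a;
  emvDr : forall x a b, emv x (a + b) = emv x a + emv x b;
  emv1 : forall x, emv x 1 = x;
  emvM : forall x a b, emv x (a * b) = emv (emv x a) b;
  emeDl : forall x z y, eme (x + z) y = eme x y + eme z y;
  emeDr : forall x y y', eme x (y + y') = eme x y + eme x y';
  eme_emv : forall x a y, eme (emv x a) y = eme x (lact a y);
  emv_eme : forall x y b, emv (eme x y) b = eme x (ract y b);
  eme_inj : forall x, (forall y, eme x y = 0) -> x = 0;
  eme_surj : forall h : kE1 k E -> em_sort,
    (forall y y', h (y + y') = h y + h y') ->
    (forall y b, h (ract y b) = emv (h y) b) ->
    exists x, forall y, h y = eme x y
}.
Arguments emv {k E D} : rename.
Arguments eme {k E D} : rename.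

Section EdgeModule.
Context (k : fieldType) (E : digraph) (D : edge_module k E).
Notation L := (leavitt_sort k E).
Implicit Types (x z : D) (y : kE1 k E) (e : edge E) (t u : lterm k E).

Let emvB x z a : emv (x - z) a = emv x a - emv z a.
Proof. by apply: (@morphDB D D (fun z => emv z a)) => ? ?; exact: emvDl. Qed.
Let emeB x z y : eme (x - z) y = eme x y - eme z y.
Proof. by apply: (@morphDB D D (fun z => eme z y)) => ? ?; exact: emeDl. Qed.
Let emv0 a : emv (0 : D) a = 0.
Proof. by apply: (@morphD0 D D (fun z => emv z a)) => ? ?; exact: emvDl. Qed.
Let eme0 y : eme (0 : D) y = 0.
Proof. by apply: (@morphD0 D D (fun z => eme z y)) => ? ?; exact: emeDl. Qed.
Let emvr0 x : emv x 0 = 0.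
Proof. by apply: (@morphD0 (kE0 k E) D (emv x)) => ? ?; exact: emvDr. Qed.
Let emer0 x : eme x 0 = 0.
Proof. by apply: (@morphD0 (kE1 k E) D (eme x)) => ? ?; exact: emeDr. Qed.

Let emvN x a : emv (- x) a = - emv x a.
Proof. by rewrite -[- x]sub0r emvB emv0 sub0r. Qed.

Lemma eme_ext x z : (forall y, eme x y = eme z y) -> x = z.
Proof.
move=> xz; apply/eqP; rewrite -subr_eq0; apply/eqP/eme_inj => y.
by rewrite emeB xz subrr.
Qed.

Lemma ghost_exists e x : exists z, forall y, emv x (edge_part e y) = eme z y.
Proof.
apply: (eme_surj (h := fun y => emv x (edge_part e y))) => [y y'|y b].
  by rewrite edge_partD emvDr.
by rewrite edge_part_ract emvM.
Qed.

Definition emg e x : D := projT1 (cid (ghost_exists e x)).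

Lemma emgE e x y : eme (emg e x) y = emv x (edge_part e y).
Proof. by rewrite /emg; case: cid. Qed.

Fixpoint lterm_act t x : D :=
  match t with
  | LVert v => emv x (kvert k v)
  | LEdge e => eme x (kedge k e)
  | LGhost e => emg e x
  | LZero => 0
  | LAdd t u => lterm_act t x + lterm_act u x
  | LOpp t => - lterm_act t x
  | LScale c t => emv (lterm_act t x) (kscal c)
  | LMul t u => lterm_act u (lterm_act t x)
  end.

Lemma lterm_actD t x z : lterm_act t (x + z) = lterm_act t x + lterm_act t z.
Proof.
elim: t x z => [v|e|e||t ht u hu|t ht|c t ht|t ht u hu] x z /=.
- exact: emvDl.
- exact: emeDl.
- by apply: eme_ext => y; rewrite emeDl !emgE emvDl.
- by rewrite addr0.
- by rewrite ht hu addrACA.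
- by rewrite ht opprD.
- by rewrite ht emvDl.
- by rewrite ht hu.
Qed.

Let emvC x a c : emv (emv x a) (kscal c) = emv (emv x (kscal c)) a.
Proof. by rewrite -!emvM kscalC. Qed.

Lemma lterm_actZ t c x :
  lterm_act t (emv x (kscal c)) = emv (lterm_act t x) (kscal c).
Proof.
elim: t x => [v|e|e||t ht u hu|t ht|d t ht|t ht u hu] x /=.
- by rewrite emvC.
- by rewrite eme_emv emv_eme lractk.
- by apply: eme_ext => y; rewrite eme_emv lractk -emv_eme !emgE emvC.
- by rewrite emv0.
- by rewrite ht hu emvDl.
- by rewrite ht emvN.
- by rewrite ht emvC.
- by rewrite ht hu.
Qed.

Let lterm_act_sum s x : lterm_act (lsum s) x = \sum_(t <- s) lterm_act t x.
Proof. by elim: s => [|t s ih]; rewrite ?big_nil ?big_cons //= ih. Qed.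

Let emv_if (b : bool) v x : emv x (if b then kvert k v else 0) =
  lterm_act (if b then LVert v else LZero) x.
Proof. by case: b. Qed.

(** The relations that involve ghost edges, apart from [e^* f], are checked after
    multiplication by an arbitrary edge, where [emgE] removes the ghost edge. *)
Lemma lterm_act_cong t u : lcong t u -> forall x, lterm_act t x = lterm_act u x.
Proof.
elim=> {t u} /=.
- by [].
- by move=> *; symmetry.
- by move=> t u w _ h _ h' x; rewrite h h'.
- by move=> t t' u u' _ h _ h' x; rewrite h h'.
- by move=> t t' _ h x; rewrite h.
- by move=> c t t' _ h x; rewrite h.
- by move=> t t' u u' _ h _ h' x; rewrite h h'.
- by move=> *; rewrite addrA.
- by move=> *; rewrite addrC.
- by move=> *; rewrite add0r.
- by move=> *; rewrite addNr.
- by move=> c d t x; rewrite -emvM -rmorphM mulrC.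
- by move=> t x; rewrite rmorph1 emv1.
- by move=> *; rewrite emvDl.
- by move=> c d t x; rewrite rmorphD emvDr.
- by [].
- by move=> *; rewrite lterm_actD.
- by [].
- by move=> c t u x; rewrite lterm_actZ.
- by [].
- by move=> v v' x; rewrite -emvM kvertM emv_if.
- by move=> e x; rewrite eme_emv [lact _ _]kE1_lact_basis eqxx.
- by move=> e x; rewrite emv_eme [ract _ _]kE1_ract_basis eqxx.
- move=> e x; apply: eme_ext => y; rewrite !emgE -emvM; congr emv.
  apply/ffunP => v; rewrite !ffunE; case: eqP => _; first by rewrite mul1r.
  by rewrite mul0r mulr0.
- move=> e x; apply: eme_ext => y; rewrite eme_emv !emgE; congr emv.
  by apply/ffunP => v; rewrite !ffunE eqxx mul1r.
- by move=> e f x; rewrite emgE edge_part_edge eq_sym emv_if.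
- move=> v x; rewrite lterm_act_sum big_map big_filter big_enum_cond /=.
  apply: eme_ext => y; rewrite eme_emv -kE1_sum_edges_at.
  rewrite (big_morph (eme x) (emeDr x) (emer0 x)).
  rewrite (big_morph (fun z => eme z y) (fun z z' => emeDl z z' y) (eme0 y)).
  by apply: eq_bigr => e _; rewrite emgE emv_eme.
Qed.

(** An alias, so that the module structure over the algebra is attached to it and not
    to the underlying group. *)
Definition em_carrier : Type := D.
HB.instance Definition _ := GRing.Zmodule.on em_carrier.

Definition em_scale (a : L^c) (x : em_carrier) : em_carrier := lterm_act (repr (a : L)) x.

Let em_scaleE t x : em_scale (lcl t : L) x = lterm_act t x.
Proof. by apply: lterm_act_cong; exact: repr_lcl. Qed.

Let em_scaleA a b x : em_scale a (em_scale b x) = em_scale (a * b) x.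
Proof.
have -> : a * b = lcl (LMul (repr (b : L)) (repr (a : L))) by [].
by rewrite em_scaleE.
Qed.

Let em_scale1 : left_id 1 em_scale.
Proof.
move=> x; rewrite [LHS]em_scaleE lterm_act_sum big_map big_enum /=.
rewrite -[RHS]emv1 -(kE0_sum_verts 1) (big_morph (emv x) (emvDr x) (emvr0 x)).
by apply: eq_bigr => v _; rewrite ffunE -[kscal 1]/(kscal (1 : k)) rmorph1 mulr1.
Qed.

Let em_scaleDr : right_distributive em_scale +%R.
Proof. by move=> a x z; exact: lterm_actD. Qed.

Let em_scaleDl x : {morph em_scale^~ x : a b / a + b}.
Proof.
move=> a b; have -> : a + b = lcl (LAdd (repr (a : L)) (repr (b : L))) by [].
by rewrite em_scaleE.
Qed.

HB.instance Definition _ :=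
  GRing.Zmodule_isLmodule.Build L^c em_carrier em_scaleA em_scale1 em_scaleDr em_scaleDl.

Definition em_mod : right_mod k E := em_carrier.

Let em_modE t (x : em_mod) : (lcl t : L^c) *: x = lterm_act t x.
Proof. exact: em_scaleE. Qed.

Lemma em_vact (x : em_mod) a : vact x a = emv x a.
Proof.
rewrite /vact /vert_alg scaler_suml.
rewrite -[in RHS](kE0_sum_verts a).
rewrite (big_morph (emv x) (emvDr x) (emvr0 x)); apply: eq_bigr => v _.
by rewrite -lclZ em_modE /= -emvM.
Qed.

Lemma em_eact (x : em_mod) y : eact x y = eme x y.
Proof.
rewrite /eact /edge_alg scaler_suml -[in RHS](kE1_sum_edges y).
rewrite (big_morph (eme x) (emeDr x) (emer0 x)); apply: eq_bigr => e _.
rewrite -lclZ em_modE /= emv_eme; congr eme; apply/ffunP => f; rewrite !ffunE.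
by case: (f =P e) => [->|_]; rewrite ?eqxx ?mul1r ?mulr1 ?mul0r.
Qed.

End EdgeModule.
(** * Right linear maps from a bimodule to a module *)

Lemma biiso_inv (k : fieldType) (A B : kalgebra k) (X Y : bimodule A B) (f : biiso X Y) :
  exists g : bihom Y X, cancel f g /\ cancel g f.
Proof.
have [g fK gK] := bi_bij f.
have gD t u : g (t + u) = g t + g u by apply: (can_inj fK); rewrite bihomD !gK.
have gl a t : g (lact a t) = lact a (g t) by apply: (can_inj fK); rewrite bihom_l !gK.
have gr t a : g (ract t a) = ract (g t) a by apply: (can_inj fK); rewrite bihom_r !gK.
by exists (Bihom gD gl gr).
Qed.

Lemma right_linear_lift (k : fieldType) (E : digraph) (A B : kalgebra k)
    (X : bimodule A B) (Y : bimodule B (kE0 k E)) (V : right_mod k E) (f : X -> Y -> V) :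
  balanced f -> (forall x y a, f x (ract y a) = vact (f x y) a) ->
  right_linear (B := X ⊗ Y) (tens_lift f).
Proof.
move=> bal fr; split=> [t u|t a]; first exact: tens_liftD.
apply: (tens_ext (f := fun t : X ⊗ Y => tens_lift f (ract t a))
  (g := fun t => vact (tens_lift f t) a) _ _ _ t) => [u v|u v|x y].
- by rewrite ractDl (tens_liftD bal).
- by rewrite (tens_liftD bal) vactDl.
- by rewrite [ract _ _]tens_ractE !(tens_liftE bal) fr.
Qed.

Section RightHom.
Context (k : fieldType) (E : digraph) (A : kalgebra k).
Context (B : bimodule A (kE0 k E)) (V : right_mod k E).

Record rhom := Rhom { rh_fun :> B -> V; rh_lin : right_linear rh_fun }.

Lemma rhomD (f : rhom) x y : f (x + y) = f x + f y.
Proof. exact: rlD (rh_lin f) x y. Qed.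
Lemma rhomM (f : rhom) x a : f (ract x a) = vact (f x) a.
Proof. exact: rlM (rh_lin f) x a. Qed.

Lemma rhom_ext (f g : rhom) : f =1 g -> f = g.
Proof.
by case: f g => [f hf] [g hg] /= /funext fg; subst g; rewrite (Prop_irrelevance hf hg).
Qed.

HB.instance Definition _ := gen_eqMixin rhom.
HB.instance Definition _ := gen_choiceMixin rhom.

Lemma vact0 a : vact (0 : V) a = 0.
Proof. exact: scaler0. Qed.
Lemma vactN (x : V) a : vact (- x) a = - vact x a.
Proof. exact: scalerN. Qed.

Lemma right_linear0 : right_linear (fun _ : B => 0 : V).
Proof. by split=> [x y|x a]; rewrite ?addr0 ?vact0. Qed.
Lemma right_linearN (f : rhom) : right_linear (fun x => - f x).
Proof. by split=> [x y|x a]; rewrite ?rhomD ?opprD // rhomM vactN. Qed.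
Lemma right_linearD (f g : rhom) : right_linear (fun x => f x + g x).
Proof. by split=> [x y|x a]; rewrite ?rhomD ?rhomM ?vactDl // addrACA. Qed.

Definition rhom_add f g := Rhom (right_linearD f g).
Definition rhom_opp f := Rhom (right_linearN f).
Definition rhom_zero := Rhom right_linear0.

Let rhom_addA : associative rhom_add.
Proof. by move=> f g h; apply: rhom_ext => x /=; rewrite addrA. Qed.
Let rhom_addC : commutative rhom_add.
Proof. by move=> f g; apply: rhom_ext => x /=; rewrite addrC. Qed.
Let rhom_add0 : left_id rhom_zero rhom_add.
Proof. by move=> f; apply: rhom_ext => x /=; rewrite add0r. Qed.
Let rhom_addN : left_inverse rhom_zero rhom_opp rhom_add.
Proof. by move=> f; apply: rhom_ext => x /=; rewrite addNr. Qed.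

HB.instance Definition _ :=
  GRing.isZmodule.Build rhom rhom_addA rhom_addC rhom_add0 rhom_addN.

End RightHom.

(** An element [y] of [kF1] acts on [f : N -> V] by moving [y] past [N] with
    [sigma] and letting the resulting edges of [E] act on the values of [f]. *)
Section HomEdgeModule.
Context (k : fieldType) (E F : digraph).
Context (N : bimodule (kE0 k F) (kE0 k E)) (sigma : biiso (kE1 k F ⊗ N) (N ⊗ kE1 k E)).
Context (V : right_mod k E).
Notation H := (rhom N V).
Implicit Types (f g : H).

Lemma rhom_bal f : balanced (fun n y => eact (f n) y).
Proof.
split=> *; first by rewrite rhomD eactDl.
  by rewrite eactDr.
by rewrite rhomM eact_vact.
Qed.

Definition eval_edge f : N ⊗ kE1 k E -> V := tens_lift (fun n y => eact (f n) y).

Lemma eval_edgeE f n y : eval_edge f (tens n y) = eact (f n) y.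
Proof. exact: tens_liftE (rhom_bal f) n y. Qed.

Lemma eval_edge_lin f : right_linear (eval_edge f).
Proof.
by apply: right_linear_lift (rhom_bal f) _ => n y a; rewrite vact_eact.
Qed.

Lemma eval_edgeD f g t : eval_edge (f + g) t = eval_edge f t + eval_edge g t.
Proof.
apply: (tens_ext (f := eval_edge (f + g)) (g := fun t => eval_edge f t + eval_edge g t)).
- exact: rlD (eval_edge_lin _).
- by move=> u v; rewrite !(rlD (eval_edge_lin _)) addrACA.
- by move=> n y; rewrite !eval_edgeE -eactDl.
Qed.

Lemma rhom_vact_lin f (a : kE0 k F) : right_linear (fun n => f (lact a n)).
Proof. by split=> [x y|x b]; rewrite ?lactDr ?rhomD // -lractA rhomM. Qed.

Lemma rhom_eact_lin f y : right_linear (fun n => eval_edge f (sigma (tens y n))).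
Proof.
split=> [n n'|n b]; first by rewrite tensDr bihomD (rlD (eval_edge_lin f)).
rewrite -(rlM (eval_edge_lin f)) -bihom_r; congr (eval_edge f (sigma _)).
by rewrite [RHS]tens_ractE.
Qed.

Definition rhom_v f a : H := Rhom (rhom_vact_lin f a).
Definition rhom_e f y : H := Rhom (rhom_eact_lin f y).

Lemma eval_edge_lact f a t : eval_edge (rhom_v f a) t = eval_edge f (lact a t).
Proof.
apply: (tens_ext (f := eval_edge (rhom_v f a)) (g := fun t => eval_edge f (lact a t))).
- exact: rlD (eval_edge_lin _).
- by move=> u v; rewrite lactDr (rlD (eval_edge_lin _)).
- by move=> n y; rewrite [lact _ _]tens_lactE !eval_edgeE.
Qed.

Lemma rhom_e_v f a y : rhom_e (rhom_v f a) y = rhom_e f (lact a y).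
Proof.
apply: rhom_ext => n /=; rewrite eval_edge_lact -bihom_l; congr (eval_edge f (sigma _)).
exact: tens_lactE.
Qed.

Lemma rhom_v_e f y b : rhom_v (rhom_e f y) b = rhom_e f (ract y b).
Proof. by apply: rhom_ext => n /=; rewrite tensM. Qed.

Lemma eval_edge_inj f : (forall t, eval_edge f t = 0) -> f = 0.
Proof.
by move=> f0; apply: rhom_ext => n; apply: eact_inj => y; rewrite -eval_edgeE f0.
Qed.

(** Tensor-hom adjunction, together with the bijection of [V] onto the right linear
    maps from [kE1] to [V]. *)
Lemma eval_edge_surj (h : N ⊗ kE1 k E -> V) :
  right_linear h -> exists f, forall t, h t = eval_edge f t.
Proof.
move=> hl; have ex n : exists x, forall y, h (tens n y) = eact x y.
  apply: eact_surj; split=> [y y'|y a]; first by rewrite tensDr (rlD hl).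
  by rewrite -(rlM hl); congr h; rewrite [RHS]tens_ractE.
pose f n := projT1 (cid (ex n)).
have fE n y : h (tens n y) = eact (f n) y by rewrite /f; case: cid.
have fl : right_linear f.
  split=> [n n'|n a]; apply: eact_ext => y.
    by rewrite eactDl -!fE tensDl (rlD hl).
  by rewrite eact_vact -!fE tensM.
exists (Rhom fl); apply: tens_ext => [||n y].
- exact: rlD hl.
- exact: rlD (eval_edge_lin _).
- by rewrite eval_edgeE fE.
Qed.

Lemma rhom_e_inj f : (forall y, rhom_e f y = 0) -> f = 0.
Proof.
have [tau [_ ts]] := biiso_inv sigma.
move=> f0; apply: eval_edge_inj => t; rewrite -[t]ts.
apply: (tens_ext (f := fun t => eval_edge f (sigma t)) (g := fun=> 0)) => [u v|u v|y n].
- by rewrite bihomD (rlD (eval_edge_lin f)).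
- by rewrite addr0.
- by rewrite -[LHS]/(rhom_e f y n) f0.
Qed.

(** A family [h] in [Hom(kF1, Hom(N, V))] is a map on [kF1 ⊗ N], hence by [sigma] a map
    on [N ⊗ kE1]. *)
Lemma rhom_e_surj (h : kE1 k F -> H) :
  (forall y y', h (y + y') = h y + h y') ->
  (forall y b, h (ract y b) = rhom_v (h y) b) ->
  exists f, forall y, h y = rhom_e f y.
Proof.
move=> hD hM; have [tau [st _]] := biiso_inv sigma.
have bal : balanced (fun (y : kE1 k F) (n : N) => h y n).
  by split=> [y y' n|y n n'|y b n]; rewrite ?hD ?rhomD ?hM.
have [|f fE] := @eval_edge_surj (fun t => tens_lift (fun y n => h y n) (tau t)).
  split=> [t u|t b]; first by rewrite bihomD (tens_liftD bal).
  by rewrite bihom_r (rlM (right_linear_lift bal (fun y n => rhomM (h y) n))).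
by exists f => y; apply: rhom_ext => n; rewrite -[RHS]fE st (tens_liftE bal).
Qed.

Definition hom_edge_module : edge_module k F.
Proof.
refine (@EdgeModule k F H rhom_v rhom_e _ _ _ _ _ _ rhom_e_v rhom_v_e rhom_e_inj rhom_e_surj).
- by move=> f g a; apply: rhom_ext.
- by move=> f a b; apply: rhom_ext => n /=; rewrite lactDl rhomD.
- by move=> f; apply: rhom_ext => n /=; rewrite lact1.
- by move=> f a b; apply: rhom_ext => n /=; rewrite lactM.
- by move=> f g y; apply: rhom_ext => n; exact: eval_edgeD.
- by move=> f y y'; apply: rhom_ext => n /=; rewrite tensDl bihomD (rlD (eval_edge_lin f)).
Defined.

Definition hom_mod : right_mod k F := em_mod hom_edge_module.

Lemma hom_mod_vact (f : hom_mod) a n : (vact f a : H) n = (f : H) (lact a n).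
Proof. by rewrite em_vact. Qed.

Lemma hom_mod_eact (f : hom_mod) y n :
  (eact f y : H) n = eval_edge (f : H) (sigma (tens y n)).
Proof. by rewrite em_eact. Qed.

End HomEdgeModule.
(** * The functor of right linear maps *)

Section HomFunctor.
Context (k : fieldType).

Section MkLinear.
Context (E : digraph) (V W : right_mod k E) (g : V -> W).
Hypothesis gD : forall x y, g (x + y) = g x + g y.
Hypothesis gv : forall x a, g (vact x a) = vact (g x) a.
Hypothesis ge : forall x y, g (eact x y) = eact (g x) y.

Lemma edge_linear : linear g.
Proof. by move=> a x z; rewrite gD (linear_of_edges gD gv ge). Qed.

Definition mk_linear : {linear V -> W} :=
  HB.pack g (GRing.isLinear.Build _ _ _ _ g edge_linear).

End MkLinear.

Context (E F : digraph).
Context (N : bimodule (kE0 k F) (kE0 k E)) (sigma : biiso (kE1 k F ⊗ N) (N ⊗ kE1 k E)).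

Section Map.
Context (V W : right_mod k E) (g : {linear V -> W}).

Lemma linear_vact x a : g (vact x a) = vact (g x) a.
Proof. exact: linearZ. Qed.
Lemma linear_eact x y : g (eact x y) = eact (g x) y.
Proof. exact: linearZ. Qed.

Lemma rhom_comp_lin (f : rhom N V) : right_linear (fun n => g (f n)).
Proof. by split=> *; rewrite ?rhomD ?raddfD // rhomM linear_vact. Qed.

Definition rhom_comp (f : rhom N V) : rhom N W := Rhom (rhom_comp_lin f).

Lemma eval_edge_comp f t : eval_edge (rhom_comp f) t = g (eval_edge f t).
Proof.
apply: (tens_ext (f := eval_edge _) (g := fun t => g (eval_edge f t))).
- exact: rlD (eval_edge_lin _).
- by move=> u v; rewrite (rlD (eval_edge_lin _)) raddfD.
- by move=> n y; rewrite !eval_edgeE /= linear_eact.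
Qed.

Definition hom_map : {linear hom_mod sigma V -> hom_mod sigma W}.
Proof.
apply: (@mk_linear F (hom_mod sigma V) (hom_mod sigma W) rhom_comp).
- by move=> f h; apply: rhom_ext => n /=; rewrite raddfD.
- by move=> f a; apply: rhom_ext => n /=; rewrite !hom_mod_vact.
- by move=> f y; apply: rhom_ext => n /=; rewrite !hom_mod_eact eval_edge_comp.
Defined.

End Map.

Definition hom_functor : functor (Mod (leavitt k E)) (Mod (leavitt k F)).
Proof.
apply: (@Functor (Mod (leavitt k E)) (Mod (leavitt k F)) (hom_mod sigma) hom_map).
- by move=> V; apply: linear_ext => f; apply: rhom_ext.
- by move=> U V W g f; apply: linear_ext => h; apply: rhom_ext.
Defined.

End HomFunctor.
(** * The natural isomorphism from the identity to the composite functor *)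

Section PathAction.
Context (k : fieldType) (E : digraph).

(** The action of a tensor of edges is the successive action of its factors, from left
    to right. *)
Fixpoint path_act (V : right_mod k E) (m : nat) (x : V) : kE1powS k E m -> V :=
  if m is m'.+1 return kE1powS k E m -> V
  then tens_lift (fun (p : kE1powS k E m') (y : kE1 k E) => eact (path_act x p) y)
  else eact x.

Section Theory.
Context (V : right_mod k E).
Implicit Types (x : V) (y : kE1 k E).

Lemma path_act_lin m x : right_linear (path_act x : kE1powS k E m -> V).
Proof.
elim: m => [|m [pD pM]] /=; first by split=> *; rewrite ?eactDr ?vact_eact.
apply: right_linear_lift => [|p y a]; last by rewrite vact_eact.
by split=> *; rewrite ?pD ?eactDl ?eactDr // pM eact_vact.
Qed.

Lemma path_act_tens m x (p : kE1powS k E m) y :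
  path_act x (tens p y : kE1powS k E m.+1) = eact (path_act x p) y.
Proof.
have [pD pM] := path_act_lin m x.
apply: (tens_liftE (f := fun (p : kE1powS k E m) y => eact (path_act x p) y)).
by split=> *; rewrite ?pD ?eactDl ?eactDr // pM eact_vact.
Qed.

Lemma path_actDl m x z (p : kE1powS k E m) :
  path_act (x + z) p = path_act x p + path_act z p.
Proof.
elim: m p => [|m ih] p; first exact: eactDl.
apply: (tens_ext (f := path_act (x + z) : kE1powS k E m.+1 -> V)
  (g := fun p : kE1powS k E m.+1 => path_act x p + path_act z p) _ _ _ p) => [u v|u v|q y].
- exact: rlD (path_act_lin m.+1 _) _ _.
- by rewrite !(rlD (path_act_lin m.+1 _)) addrACA.
- by rewrite !path_act_tens ih eactDl.
Qed.

Lemma path_act_vact m x a (p : kE1powS k E m) :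
  path_act (vact x a) p = path_act x (lact a p).
Proof.
elim: m p => [|m ih] p; first exact: eact_vact.
apply: (tens_ext (f := path_act (vact x a) : kE1powS k E m.+1 -> V)
  (g := fun p : kE1powS k E m.+1 => path_act x (lact a p)) _ _ _ p) => [u v|u v|q y].
- exact: rlD (path_act_lin m.+1 _) _ _.
- by rewrite lactDr (rlD (path_act_lin m.+1 _)).
- by rewrite [lact _ _]tens_lactE !path_act_tens ih.
Qed.

(** Both sides act by [y] and then by [p]: [nu] only moves the brackets. *)
Lemma path_act_nu m x y (p : kE1powS k E m) :
  path_act x (nuS k E m (tens y p) : kE1powS k E m.+1) = path_act (eact x y) p.
Proof.
elim: m p => [|m ih] p; first exact: (@path_act_tens 0 x y p).
apply: (tens_ext
  (f := fun p : kE1powS k E m.+1 => path_act x (nuS k E m.+1 (tens y p) : kE1powS k E m.+2))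
  (g := path_act (eact x y) : kE1powS k E m.+1 -> V) _ _ _ p) => [u v|u v|q z].
- by rewrite tensDr bihomD (rlD (path_act_lin m.+2 _)).
- exact: rlD (path_act_lin m.+1 _) _ _.
- rewrite [nuS k E m.+1 _]bi_compE assoc_invE tens_mapE.
  by rewrite path_act_tens ih path_act_tens.
Qed.

Lemma path_act_inj m x : (forall p : kE1powS k E m, path_act x p = 0) -> x = 0.
Proof.
elim: m => [|m ih] x0; first exact: eact_inj.
by apply: ih => p; apply: eact_inj => y; rewrite -path_act_tens x0.
Qed.

(** Currying a map on [p ⊗ y] in the last factor reduces the power by one. *)
Lemma path_act_surj m (h : kE1powS k E m -> V) :
  right_linear h -> exists x, forall p, h p = path_act x p.
Proof.
elim: m h => [|m ih] h hl; first exact: eact_surj.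
have ex p : exists x, forall y, h (tens p y) = eact x y.
  apply: eact_surj; split=> [y y'|y a]; first by rewrite tensDr (rlD hl).
  by rewrite -(rlM hl); congr h; rewrite [RHS]tens_ractE.
pose f p := projT1 (cid (ex p)).
have fE p y : h (tens p y) = eact (f p) y by rewrite /f; case: cid.
have [|x xE] := ih f.
  split=> [p p'|p a]; apply: eact_ext => y.
    by rewrite eactDl -!fE tensDl (rlD hl).
  by rewrite eact_vact -!fE tensM.
exists x; apply: tens_ext => [||p y].
- exact: rlD hl.
- exact: rlD (path_act_lin m.+1 _).
- by rewrite path_act_tens fE xE.
Qed.

End Theory.

Lemma path_act_linear (V W : right_mod k E) (g : {linear V -> W}) m x (p : kE1powS k E m) :
  g (path_act x p) = path_act (g x) p.
Proof.
elim: m p => [|m ih] p; first exact: linear_eact.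
apply: (tens_ext (f := fun p : kE1powS k E m.+1 => g (path_act x p))
  (g := path_act (g x) : kE1powS k E m.+1 -> W) _ _ _ p) => [u v|u v|q y].
- by rewrite (rlD (path_act_lin m.+1 _)) raddfD.
- exact: rlD (path_act_lin m.+1 _) _ _.
- by rewrite !path_act_tens linear_eact ih.
Qed.

End PathAction.

Section Unit.
Context (k : fieldType) (E F : digraph).
Context (M : bimodule (kE0 k E) (kE0 k F)) (N : bimodule (kE0 k F) (kE0 k E)) (m : nat).
Context (omega : biiso (M ⊗ N) (kE1powS k E m)).
Context (sigmaM : biiso (kE1 k E ⊗ M) (M ⊗ kE1 k F)).
Context (sigmaN : biiso (kE1 k F ⊗ N) (N ⊗ kE1 k E)).
Hypothesis omegaE : bi_comp (omega ⊗m bi_id (kE1 k E)) (sharp sigmaM sigmaN)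
  =1 bi_comp (nuS k E m) (bi_id (kE1 k E) ⊗m omega).

Section At.
Context (V : right_mod k E).
Notation HV := (hom_mod sigmaN V).
Notation HHV := (hom_mod sigmaM HV).

Lemma unit_lin1 (x : V) (u : M) : right_linear (fun v : N => path_act x (omega (tens u v))).
Proof.
have [pD pM] := path_act_lin m x; split=> [v v'|v a]; first by rewrite tensDr bihomD pD.
by rewrite -pM -bihom_r; congr (path_act x (omega _)); rewrite [RHS]tens_ractE.
Qed.

Lemma unit_lin2 (x : V) : right_linear (fun u : M => Rhom (unit_lin1 x u) : HV).
Proof.
split=> [u u'|u a]; apply: rhom_ext => v /=.
  by rewrite tensDl bihomD (rlD (path_act_lin m x)).
by rewrite hom_mod_vact /= tensM.
Qed.

Definition unit_fun (x : V) : HHV := Rhom (unit_lin2 x) : rhom M HV.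

Lemma unit_funE x u v : ((unit_fun x : rhom M HV) u : rhom N V) v = path_act x (omega (tens u v)).
Proof. by []. Qed.

Lemma eval_unit1 x u (t : N ⊗ kE1 k E) :
  eval_edge ((unit_fun x : rhom M HV) u : rhom N V) t =
  path_act x ((omega ⊗m bi_id (kE1 k E)) (assoc_inv M N (kE1 k E) (tens u t)) : kE1powS k E m.+1).
Proof.
have [pD pM] := path_act_lin m.+1 x.
apply: (tens_ext (f := eval_edge _) (g := fun t => path_act x
  ((omega ⊗m bi_id (kE1 k E)) (assoc_inv M N (kE1 k E) (tens u t)) : kE1powS k E m.+1)))
  => [||v y].
- exact: rlD (eval_edge_lin _).
- by move=> t1 t2; rewrite tensDr !bihomD pD.
- by rewrite eval_edgeE assoc_invE tens_mapE path_act_tens.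
Qed.

Lemma eval_unit2 x (t : M ⊗ kE1 k F) v :
  (eval_edge (unit_fun x : rhom M HV) t : rhom N V) v =
  path_act x ((omega ⊗m bi_id (kE1 k E)) (assoc_inv M N (kE1 k E)
    ((bi_id M ⊗m sigmaN) (assoc M (kE1 k F) N (tens t v)))) : kE1powS k E m.+1).
Proof.
have [pD pM] := path_act_lin m.+1 x.
apply: (tens_ext (f := fun t => (eval_edge (unit_fun x : rhom M HV) t : rhom N V) v)
  (g := fun t => path_act x ((omega ⊗m bi_id (kE1 k E)) (assoc_inv M N (kE1 k E)
    ((bi_id M ⊗m sigmaN) (assoc M (kE1 k F) N (tens t v)))) : kE1powS k E m.+1))) => [||u y].
- by move=> t1 t2; rewrite (rlD (eval_edge_lin _)).
- by move=> t1 t2; rewrite tensDl !bihomD pD.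
- by rewrite eval_edgeE hom_mod_eact eval_unit1 assocE tens_mapE.
Qed.

(** Commutation with the edges is where the compatibility of [omega], [sigmaM] and
    [sigmaN] enters: moving an edge past [M] and then past [N] with the two [sigma]
    is the action of [sharp sigmaM sigmaN], by [eval_unit2]. *)
Definition unit_map : {linear V -> HHV}.
Proof.
apply: (@mk_linear k E V HHV unit_fun).
- move=> x z; apply: rhom_ext => u; apply: rhom_ext => v; exact: path_actDl.
- move=> x a; apply: rhom_ext => u; rewrite hom_mod_vact; apply: rhom_ext => v.
  rewrite !unit_funE path_act_vact -bihom_l; congr (path_act x (omega _)).
  exact: tens_lactE.
- move=> x y; apply: rhom_ext => u; rewrite hom_mod_eact; apply: rhom_ext => v.
  rewrite eval_unit2 unit_funE -path_act_nu.
  have := omegaE (tens y (tens u v)); rewrite !bi_compE tens_mapE => <-.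
  by rewrite assoc_invE tens_mapE.
Defined.

Lemma unit_mapE x u v :
  ((unit_map x : rhom M HV) u : rhom N V) v = path_act x (omega (tens u v)).
Proof. by []. Qed.

Lemma unit_inj : injective unit_map.
Proof.
have [tau [_ ot]] := biiso_inv omega.
move=> x1 x2 xE; apply/eqP; rewrite -subr_eq0; apply/eqP.
have : unit_map (x1 - x2) = 0 by rewrite (linearB unit_map) xE subrr.
move: (x1 - x2) => x x0; apply: (@path_act_inj k E V m) => p; rewrite -[p]ot.
apply: (tens_ext (f := fun t => path_act x (omega t)) (g := fun=> 0)) => [t u|t u|u v].
- by rewrite bihomD (rlD (path_act_lin m x)).
- by rewrite addr0.
- by rewrite -unit_mapE x0.
Qed.

(** A map [M -> Hom(N, V)] is a map on [M ⊗ N], hence by [omega] a map on a power of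
    [kE1], and such a map is the action on some element of [V]. *)
Lemma unit_surj (f : HHV) : exists x, unit_map x = f.
Proof.
have [tau [to _]] := biiso_inv omega.
pose h u v := ((f : rhom M HV) u : rhom N V) v.
have bal : balanced h.
  rewrite /h; by split=> [u u' v|u v v'|u b v]; rewrite ?rhomD // rhomM hom_mod_vact.
have hl := right_linear_lift bal (fun u v => rhomM ((f : rhom M HV) u : rhom N V) v).
have [|x xE] := @path_act_surj k E V m (fun p => tens_lift h (tau p)).
  by split=> [p q|p a]; rewrite ?bihomD ?(rlD hl) // bihom_r (rlM hl).
exists x; apply: rhom_ext => u; apply: rhom_ext => v.
by rewrite unit_mapE -xE to (tens_liftE bal).
Qed.

End At.

Lemma unit_natural (V W : right_mod k E) (g : {linear V -> W}) x :
  unit_map W (g x) = hom_map sigmaM (hom_map sigmaN g) (unit_map V x).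
Proof.
by apply: rhom_ext => u; apply: rhom_ext => v; rewrite unit_mapE -path_act_linear.
Qed.

End Unit.

Section Equivalence.

Lemma mod_iso (R : pzRingType) (V W : lmodType R^c) (f : {linear V -> W}) :
  injective f -> (forall y, exists x, f x = y) -> @is_iso (Mod R) V W f.
Proof.
move=> fI fS; pose g y := projT1 (cid (fS y)).
have gK : cancel g f by move=> y; rewrite /g; case: cid.
have gl : linear g by move=> a x y; apply: fI; rewrite linearP !gK.
pose gL : {linear W -> V} := HB.pack g (GRing.isLinear.Build _ _ _ _ g gl).
exists gL; split; apply: linear_ext => x /=; last exact: gK.
by apply: fI; exact: gK.
Qed.

Lemma nat_isomorphic_sym (C D : category) (G H : functor C D) :
  nat_isomorphic G H -> nat_isomorphic H G.
Proof.
move=> [eta [nat iso]]; exists (fun a => projT1 (cid (iso a))); split=> [a b f|a].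
- case: cid => g /= [ge eg]; case: cid => g' /= [ge' eg'].
  by rewrite -[fmap H f]compm1 -eg' (compmA (fmap H f)) -nat !compmA ge comp1m.
- by case: cid => g /= [ge eg]; exists (eta a).
Qed.

Lemma hom_functor_inverse (k : fieldType) (E F : digraph)
    (M : bimodule (kE0 k E) (kE0 k F)) (N : bimodule (kE0 k F) (kE0 k E)) (m : nat)
    (omega : biiso (M ⊗ N) (kE1powS k E m))
    (sigmaM : biiso (kE1 k E ⊗ M) (M ⊗ kE1 k F))
    (sigmaN : biiso (kE1 k F ⊗ N) (N ⊗ kE1 k E)) :
  bi_comp (omega ⊗m bi_id (kE1 k E)) (sharp sigmaM sigmaN)
    =1 bi_comp (nuS k E m) (bi_id (kE1 k E) ⊗m omega) ->
  nat_isomorphic (fun_comp (hom_functor sigmaM) (hom_functor sigmaN))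
    (fun_id (Mod (leavitt k E))).
Proof.
move=> omegaE; apply: nat_isomorphic_sym; exists (unit_map omegaE); split=> [V W g|V].
  by apply: linear_ext => x; exact: unit_natural.
by apply: mod_iso; [exact: unit_inj | exact: unit_surj].
Qed.

End Equivalence.
(** * Finite generation on the right *)

Section FinitelyGenerated.
Context (k : fieldType).

Record right_submodule (A B : kalgebra k) (X : bimodule A B) (P : X -> Prop) : Prop :=
  RightSubmodule {
    rs0 : P 0;
    rsB : forall x y, P x -> P y -> P (x - y);
    rsM : forall x b, P x -> P (ract x b)
  }.

(** Finite generation is used to prove properties that are closed under the module
    operations, and it is phrased as the corresponding induction principle. *)
Definition fg_right (A B : kalgebra k) (X : bimodule A B) :=
  exists s : seq X, forall P : X -> Prop, right_submodule P ->
    (forall x, x \in s -> P x) -> forall x, P x.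

Lemma fg_kE1 (E : digraph) : fg_right (kE1 k E).
Proof.
exists [seq (kedge k e : kE1 k E) | e <- enum (edge E)] => P [P0 PB PM] Ps x.
have PD y z : P y -> P z -> P (y + z).
  by move=> Py Pz; rewrite -[z]opprK; apply: (PB) => //; rewrite -sub0r; apply: PB.
rewrite -(kE1_sum_edges x); apply: (big_ind P) => // e _.
by apply: PM; apply: Ps; apply: map_f; rewrite mem_enum.
Qed.

Lemma fg_tensor (A B C : kalgebra k) (X : bimodule A B) (Y : bimodule B C) :
  fg_right X -> fg_right Y -> fg_right (X ⊗ Y).
Proof.
move=> [s hs] [t ht]; exists [seq (tens x y : X ⊗ Y) | x <- s, y <- t] => P [P0 PB PM] Pst.
have tensBr (x : X) (y y' : Y) : tens x (y - y') = tens x y - tens x y'.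
  by apply: (@morphDB Y (X ⊗ Y) (fun y => tens x y)) => ? ?; exact: tensDr.
have tensBl (x x' : X) (y : Y) : tens (x - x') y = tens x y - tens x' y.
  by apply: (@morphDB X (X ⊗ Y) (fun x => tens x y)) => ? ?; exact: tensDl.
have tens0r (x : X) : tens x (0 : Y) = 0.
  by apply: (@morphD0 Y (X ⊗ Y) (fun y => tens x y)) => ? ?; exact: tensDr.
have tens0l (y : Y) : tens (0 : X) y = 0.
  by apply: (@morphD0 X (X ⊗ Y) (fun x => tens x y)) => ? ?; exact: tensDl.
apply: tens_ind => //; apply: (hs (fun x => forall y, P (tens x y))).
  split=> [y|x x' Px Px' y|x b Px y]; first by rewrite tens0l.
    by rewrite tensBl; apply: PB.
  by rewrite tensM.
move=> x xs; apply: (ht (fun y => P (tens x y))).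
  split=> [|y y' Py Py'|y c Py]; first by rewrite tens0r.
    by rewrite tensBr; apply: PB.
  by rewrite -[tens _ _]tens_ractE; apply: PM.
by move=> y yt; apply: Pst; exact: allpairs_f.
Qed.

Lemma fg_kE1pow (E : digraph) m : fg_right (kE1powS k E m).
Proof. by elim: m => [|m ih]; [exact: fg_kE1 | exact: fg_tensor (fg_kE1 E)]. Qed.

Lemma fg_surj (A B : kalgebra k) (X Y : bimodule A B) (f : bihom X Y) :
  (forall y, exists x, f x = y) -> fg_right X -> fg_right Y.
Proof.
move=> fS [s hs]; exists [seq f x | x <- s] => P [P0 PB PM] Ps y.
have [x <-] := fS y; apply: (hs (fun x => P (f x))) => [|{}x xs]; last exact/Ps/map_f.
split=> [|x1 x2 P1 P2|x1 b P1]; first by rewrite (morphD0 (bihomD f)).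
  by rewrite (morphDB (bihomD f)); apply: PB.
by rewrite bihom_r; apply: PM.
Qed.

(** Choosing an edge at every vertex, which is possible since there are no sinks,
    gives a left linear map [kE1 -> kE0], the coordinates at the chosen edges, that
    sends the sum of all edges to [1]; its iterates split off [kE0] from every tensor
    power. *)
Lemma kE1pow_split (E : digraph) (hE : no_sinks E) m :
  exists lam : kE1powS k E m -> kE0 k E,
    [/\ forall x y, lam (x + y) = lam x + lam y,
        forall a x, lam (lact a x) = a * lam x
      & exists p, lam p = 1].
Proof.
pose c v := projT1 (cid (hE v)).
have cE v : src (c v) = v by rewrite /c; case: cid.
pose d (y : kE1 k E) : kE0 k E := [ffun v => (y : {ffun _ -> k}) (c v)].
have dD x y : d (x + y) = d x + d y by apply/ffunP => v; rewrite !ffunE.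
have dl a x : d (lact a x) = a * d x by apply/ffunP => v; rewrite !ffunE cE.
pose p0 : kE1 k E := [ffun=> 1].
have dp : d p0 = 1 by apply/ffunP => v; rewrite !ffunE.
elim: m => [|m [lam [lD ll [p lp]]]]; first by exists d; split=> //; exists p0.
have bal : balanced (fun (q : kE1powS k E m) (y : kE1 k E) => lam (ract q (d y))).
  split=> [q q' y|q y y'|q b y]; first by rewrite ractDl lD.
    by rewrite dD ractDr lD.
  by rewrite dl ractM.
exists (tens_lift (fun (q : kE1powS k E m) (y : kE1 k E) => lam (ract q (d y)))).
split.
- exact: tens_liftD bal.
- move=> a t.
  pose f t : kE0 k E :=
    tens_lift (fun (q : kE1powS k E m) (y : kE1 k E) => lam (ract q (d y))) t.
  apply: (tens_ext (f := fun t => f (tens_lact a t)) (g := fun t => a * f t) _ _ _ t)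
    => [u v|u v|q y].
  + by rewrite tens_lactDr /f (tens_liftD bal).
  + by rewrite /f (tens_liftD bal) mulrDr.
  + by rewrite tens_lactE /f !(tens_liftE bal) lractA ll.
- by exists (tens p p0); rewrite (tens_liftE bal) dp ract1.
Qed.

(** [N] is finitely generated on the right as soon as [N ⊗ M] is and [M ⊗ N] has a left
    linear map [lam] onto [A]. With [lam t = 1], every [x] is the image of
    [x ⊗ t] under [x ⊗ u ⊗ y |-> x lam(u ⊗ y)], and this map takes values in the
    right submodule generated by the left factors of generators of [N ⊗ M]. *)
Lemma fg_factor (A B : kalgebra k) (M : bimodule A B) (N : bimodule B A)
    (lam : M ⊗ N -> A) :
  (forall x y, lam (x + y) = lam x + lam y) ->
  (forall a x, lam (lact a x) = a * lam x) ->
  (exists t, lam t = 1) -> fg_right (N ⊗ M) -> fg_right N.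
Proof.
move=> lD ll [t0 lt0] [s hs].
pose F (y : N) (t : N ⊗ M) : N := tens_lift (fun x u => ract x (lam (tens u y))) t.
have bal y : balanced (fun (x : N) (u : M) => ract x (lam (tens u y))).
  split=> [x x' u|x u u'|x a u]; first exact: ractDl.
    by rewrite tensDl lD ractDr.
  by rewrite -ractM -ll; congr (ract x (lam _)); exact: tens_lactE.
have F0 y : F y 0 = 0 by exact: morphD0 (tens_liftD (bal y)).
have gens (t : N ⊗ M) : exists r : seq N, forall P : N -> Prop, right_submodule P ->
    (forall x, x \in r -> P x) -> forall y, P (F y t).
  elim/tens_ind: t => [x u||t t' [r hr] [r' hr']].
  - exists [:: x] => P [P0 PB PM] Pr y; rewrite /F (tens_liftE (bal y)).
    by apply/PM/Pr; rewrite mem_head.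
  - by exists [::] => P [P0 PB PM] _ y; rewrite F0.
  - exists (r ++ r') => P sP Pr y; rewrite /F (tens_liftB (bal y)); apply: (rsB sP).
      by apply: hr => // x xr; apply: Pr; rewrite mem_cat xr.
    by apply: hr' => // x xr; apply: Pr; rewrite mem_cat xr orbT.
pose r t := projT1 (cid (gens t)).
have rP t := projT2 (cid (gens t)).
exists (flatten [seq r t | t <- s]) => P sP Pr x.
have PF t y : P (F y t).
  move: t y; apply: (hs (fun t => forall y, P (F y t))) => [|t ts].
    split=> [y|t t' Pt Pt' y|t b Pt y].
    - by rewrite F0; exact: rs0 sP.
    - by rewrite /F (tens_liftB (bal y)); apply: (rsB sP); [exact: Pt | exact: Pt'].
    - suff -> : F y (ract t b) = F (lact b y) t by [].
      apply: (tens_ext (f := fun t => F y (tens_ract t b)) (g := F (lact b y)) _ _ _ t).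
      + by move=> u v; rewrite tens_ractDl /F (tens_liftD (bal y)).
      + exact: tens_liftD (bal _).
      + by move=> z u; rewrite tens_ractE /F (tens_liftE (bal _)) (tens_liftE (bal _)) tensM.
  apply: rP => // w wr; apply: Pr; apply/flattenP; exists (r t) => //; exact: map_f.
suff Pl t : P (ract x (lam t)) by rewrite -[x]ract1 -lt0.
elim/tens_ind: t => [u y||t t' Pt Pt'].
- by have := PF (tens x u) y; rewrite /F (tens_liftE (bal y)).
- have ract0 : ract x (0 : A) = 0 by apply: (@morphD0 A N (ract x)) => ? ?; exact: ractDr.
  by rewrite (morphD0 lD) ract0; exact: rs0 sP.
- have ractB (a a' : A) : ract x (a - a') = ract x a - ract x a'.
    by apply: (@morphDB A N (ract x)) => ? ?; exact: ractDr.
  by rewrite (morphDB lD) ractB; apply: (rsB sP).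
Qed.

End FinitelyGenerated.

(** * Homogeneous components *)

Section HomogeneousComponents.
Context (V : zmodType) (C : int -> V -> Prop).
Hypothesis gradC : is_grading C.

Definition decomposes (x : V) (y : int -> V) := (forall i, C i (y i)) /\
  exists s : seq int, [/\ uniq s, forall i, i \notin s -> y i = 0 & x = \sum_(i <- s) y i].

Lemma sum_support (s t : seq int) (y : int -> V) :
  uniq s -> uniq t -> {subset s <= t} -> (forall i, i \notin s -> y i = 0) ->
  \sum_(i <- s) y i = \sum_(i <- t) y i.
Proof.
move=> us ut st y0; rewrite [RHS](bigID (mem s)) /= [X in _ + X]big1 // addr0 -[RHS]big_filter.
apply: perm_big; apply: uniq_perm => //; first exact: filter_uniq.
by move=> i; rewrite mem_filter /=; case: (boolP (i \in s)) => // /st ->.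
Qed.

Lemma decomposesB x x' y y' :
  decomposes x y -> decomposes x' y' -> decomposes (x - x') (fun i => y i - y' i).
Proof.
move=> [Cy [s [us ys ->]]] [Cy' [s' [us' ys' ->]]]; split=> [i|].
  exact: (gradingB gradC).
exists (undup (s ++ s')); split; first exact: undup_uniq.
  move=> i; rewrite mem_undup mem_cat negb_or => /andP[/ys -> /ys' ->].
  by rewrite subrr.
rewrite (@sum_support s (undup (s ++ s'))) ?undup_uniq //; last first.
  by move=> i is_; rewrite mem_undup mem_cat is_.
rewrite (@sum_support s' (undup (s ++ s'))) ?undup_uniq ?sumrB //.
by move=> i is_; rewrite mem_undup mem_cat is_ orbT.
Qed.

Lemma decomposes0 : decomposes 0 (fun=> 0).
Proof. by split=> [i|]; [exact: grading0 | exists [::]; rewrite big_nil]. Qed.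

Lemma decomposes1 i x : C i x -> decomposes x (fun j => if j == i then x else 0).
Proof.
move=> Cx; split=> [j|]; first by case: eqP => [->|_] //; exact: grading0.
exists [:: i]; rewrite big_seq1 eqxx; split=> // j.
by rewrite inE => /negPf ->.
Qed.

Lemma decomposesD x x' y y' :
  decomposes x y -> decomposes x' y' -> decomposes (x + x') (fun i => y i + y' i).
Proof.
move=> dx dx'; have := decomposesB dx (decomposesB decomposes0 dx').
by rewrite sub0r opprK; congr decomposes; apply/funext => i; rewrite sub0r opprK.
Qed.

Lemma decomposes_exists x : exists y, decomposes x y.
Proof.
have [s [+ ->]] := grading_sum gradC x; elim: s => [_|p s ih sC].
  by exists (fun=> 0); rewrite big_nil; exact: decomposes0.
have [|y dy] := ih; first by move=> q qs; apply: sC; rewrite inE qs orbT.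
rewrite big_cons; eexists; apply: decomposesD dy; apply: (@decomposes1 p.1).
by apply: sC; rewrite mem_head.
Qed.

Lemma decomposes_uniq x y y' : decomposes x y -> decomposes x y' -> y = y'.
Proof.
move=> dy dy'; have [Cz [s [us zs s0]]] := decomposesB dy dy'.
apply/funext => i; apply/eqP; rewrite -subr_eq0; apply/eqP.
case: (boolP (i \in s)) => [is_|/zs //].
by apply: (grading_free gradC us Cz _ is_); rewrite -s0 subrr.
Qed.

Definition component (i : int) (x : V) : V := projT1 (cid (decomposes_exists x)) i.

Lemma componentP x : decomposes x (component ^~ x).
Proof. by rewrite /component; case: cid. Qed.

Lemma component_in i x : C i (component i x).
Proof. exact: (componentP x).1. Qed.

Lemma componentD i x x' : component i (x + x') = component i x + component i x'.
Proof.
have := decomposes_uniq (componentP (x + x')) (decomposesD (componentP x) (componentP x')).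
by move=> /(congr1 (fun f => f i)).
Qed.

(** The image of a decomposition is a decomposition when the map preserves degrees, and
    decompositions are unique; so degree-preserving additive maps commute with components. *)
Lemma component_map (f : V -> V) i x : (forall x y, f (x + y) = f x + f y) ->
  (forall i x, C i x -> C i (f x)) -> component i (f x) = f (component i x).
Proof.
move=> fD fC; have [Cx [s [us xs xE]]] := componentP x.
have f0 := morphD0 fD.
have : decomposes (f x) (fun j => f (component j x)).
  split=> [j|]; first exact: fC.
  exists s; split=> // [j /xs ->//|]; by rewrite [in LHS]xE (big_morph f fD f0).
by move=> /(decomposes_uniq (componentP (f x))) /(congr1 (fun g => g i)).
Qed.

Lemma component_support x : exists s : seq int, forall i, i \notin s -> component i x = 0.
Proof. by have [_ [s [_ xs _]]] := componentP x; exists s. Qed.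

Lemma component_sum (t : seq int) x : uniq t ->
  (forall i, i \notin t -> component i x = 0) -> x = \sum_(i <- t) component i x.
Proof.
move=> ut xt; have [_ [s [us xs xE]]] := componentP x.
have u := undup_uniq (s ++ t).
rewrite {1}xE (sum_support us u) ?[RHS](sum_support ut u) // => i it;
  by rewrite mem_undup mem_cat it ?orbT.
Qed.

End HomogeneousComponents.

(** * The grading on right linear maps *)

Section Degrees.
Context (k : fieldType) (E : digraph).
Notation L := (leavitt_sort k E).

Lemma leavitt_comp_sum (I : Type) (s : seq I) (f : I -> L) d :
  (forall i, leavitt_comp d (f i)) -> leavitt_comp d (\sum_(i <- s) f i).
Proof.
move=> fC; apply: big_ind => //; [exact: kspan0 | exact: leavitt_compD].
Qed.

Lemma vert_alg_deg (a : kE0 k E) : leavitt_comp 0 (vert_alg a).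
Proof. by apply: leavitt_comp_sum => v; apply/leavitt_compZ/leavitt_comp_v. Qed.

Lemma edge_alg_deg (y : kE1 k E) : leavitt_comp 1 (edge_alg y).
Proof. by apply: leavitt_comp_sum => v; apply/leavitt_compZ/leavitt_comp_e. Qed.

(** A graded action may be checked on the generators, since the homogeneous elements of
    the algebra are spanned by products of generators of the matching total degree. *)
Lemma act_degree (W : right_mod k E) (Q : int -> W -> Prop) :
  (forall i, Q i 0) -> (forall i x y, Q i x -> Q i y -> Q i (x + y)) ->
  (forall i x a, Q i x -> Q i (vact x a)) ->
  (forall i x y, Q i x -> Q (i + 1) (eact x y)) ->
  (forall i x e, Q i x -> Q (i - 1) ((Lg k e : L^c) *: x)) ->
  forall i j x (a : L), Q i x -> leavitt_comp j a -> Q (i + j) ((a : L^c) *: x).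
Proof.
move=> Q0 QD Qv Qe Qg i j x a Qx Ca; have QLv d z v : Q d z -> Q d ((Lv k v : L^c) *: z).
  by move=> Qz; rewrite -vert_alg_vert; exact: Qv.
have Qpath p v d z : Q d z -> Q (d + (size p)%:Z) ((path_elt k v p : L^c) *: z).
  elim: p v d z => [|e p ih] v d z Qz /=; first by rewrite addr0; exact: QLv.
  by rewrite -scaleLM intS addrA; apply: ih; rewrite -edge_alg_edge; exact: Qe.
have Qghost p v d z : Q d z -> Q (d - (size p)%:Z) ((ghost_elt k v p : L^c) *: z).
  elim: p v d z => [|e p ih] v d z Qz /=; first by rewrite subr0; exact: QLv.
  by rewrite -scaleLM intS opprD addrCA addrC; apply: Qg; exact: ih.
elim: Ca => [|c b a' [v [p [w [q [_ _ <- ->]]]]] _ ih]; first by rewrite scale0r.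
rewrite scalerDl; apply: (QD) => //.
set m := _ * _; have -> : c *: m = vert_alg (kscal c) * m.
  by rewrite vert_alg_scal scaleLl mul1r.
by rewrite -scaleLM /m -scaleLM addrA; apply/Qghost/Qpath/Qv.
Qed.

Section Graded.
Context (V : grmod (leavitt k E)).

Lemma vact_deg i (x : V) a : gm_comp i x -> gm_comp i (vact x a).
Proof. by move=> Cx; rewrite -[i]addr0; apply: gm_act => //; exact: vert_alg_deg. Qed.

Lemma eact_deg i (x : V) y : gm_comp i x -> gm_comp (i + 1) (eact x y).
Proof. by move=> Cx; apply: gm_act => //; exact: edge_alg_deg. Qed.

Lemma gm_compD i (x y : V) : gm_comp i x -> gm_comp i y -> gm_comp i (x + y).
Proof.
move=> Cx Cy; have gV := gm_grading V.
rewrite -[y]opprK -[- y]sub0r; do 2!apply: (gradingB gV) => //; exact: (grading0 gV).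
Qed.

(** Since [x = sum (x e) e^*], and [e^*] lowers the degree by one. *)
Lemma eact_deg_inv i (x : V) : (forall y, gm_comp (i + 1) (eact x y)) -> gm_comp i x.
Proof.
move=> Cx; have -> : x = \sum_e (Lg k e : L^c) *: eact x (kedge k e).
  apply: eact_ext => y; rewrite /eact scaler_sumr -[in LHS](kE1_sum_edges y).
  rewrite -/(eact x _) (big_morph (eact x) (eactDr x) (morphD0 (eactDr x))).
  by apply: eq_bigr => e _; rewrite -vact_eact /vact -ghost_edge_alg -scaleLM.
apply: big_ind => [|*|e _]; [exact: (grading0 (gm_grading V)) | exact: gm_compD |].
rewrite -[i](addrK 1); apply: gm_act => //; exact: leavitt_comp_g.
Qed.

End Graded.
End Degrees.

Section GradedHom.
Context (k : fieldType) (E F : digraph).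
Context (N : bimodule (kE0 k F) (kE0 k E)) (sigma : biiso (kE1 k F ⊗ N) (N ⊗ kE1 k E)).
Hypothesis fgN : fg_right N.

Section Object.
Context (V : grmod (leavitt k E)).
Notation H := (hom_mod sigma V).
Let gV := gm_grading V.

Definition hom_comp (i : int) (f : H) : Prop := forall n, gm_comp i ((f : rhom N V) n).

Lemma component_lin i (f : rhom N V) : right_linear (fun n => component gV i (f n)).
Proof.
split=> [n n'|n a]; first by rewrite rhomD componentD.
rewrite rhomM (component_map gV (f := fun x : V => vact x a)) //.
  by move=> x y; exact: vactDl.
by move=> j x; exact: vact_deg.
Qed.

Lemma hom_sumE (I : Type) (s : seq I) (f : I -> H) n :
  ((\sum_(i <- s) f i : H) : rhom N V) n = \sum_(i <- s) (f i : rhom N V) n.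
Proof. by elim: s => [|i s ih]; rewrite ?big_nil // !big_cons -ih. Qed.

(** The components of [f] are the maps obtained from the components of its values. Only
    finitely many are nonzero, since a component of [f] that vanishes on generators of
    [N] vanishes. *)
Lemma hom_grading : is_grading hom_comp.
Proof.
split=> [i n|i f g hf hg n|f|s f us hf sf0 i is_].
- exact: (grading0 gV).
- exact: (gradingB gV).
- have [gens hgens] := fgN.
  have [t tP] : exists t : seq int, forall n, n \in gens -> forall i, i \notin t ->
      component gV i ((f : rhom N V) n) = 0.
    elim: gens {hgens} => [|n r [t tP]]; first by exists [::].
    have [s sP] := component_support gV ((f : rhom N V) n).
    exists (s ++ t) => n'; rewrite inE => /orP[/eqP ->|n'r] i;
      rewrite mem_cat negb_or => /andP[is_ it]; [exact: sP | exact: tP].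
  have tN n i : i \notin t -> component gV i ((f : rhom N V) n) = 0.
    move=> it; move: n; apply: hgens => [|n /tP]; last exact.
    have cl := component_lin i f; have c0 := morphD0 (rlD cl).
    split=> [|x y hx hy|x b hx].
    + exact: c0.
    + by rewrite (morphDB (rlD cl)) hx hy subrr.
    + by rewrite (rlM cl) hx vact0.
  exists [seq (i, Rhom (component_lin i f) : H) | i <- undup t]; split.
    by move=> _ /mapP[i _ ->] n /=; exact: component_in.
  apply: rhom_ext => n; rewrite big_map hom_sumE /=.
  apply: component_sum; first exact: undup_uniq.
  by move=> i; rewrite mem_undup => /tN.
- apply: rhom_ext => n.
  apply: (grading_free gV us (y := fun i => (f i : rhom N V) n) (fun i => hf i n) _ is_).
  by rewrite -[LHS](hom_sumE s f n) sf0.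
Qed.

Lemma eval_edge_deg i (f : H) t : hom_comp i f ->
  gm_comp (i + 1) (eval_edge (f : rhom N V) t).
Proof.
have el := eval_edge_lin (f : rhom N V).
move=> hf; elim/tens_ind: t => [n y||t u ht hu].
- by rewrite eval_edgeE; apply: eact_deg.
- by rewrite (morphD0 (rlD el)); exact: (grading0 gV).
- by rewrite (morphDB (rlD el)); exact: (gradingB gV).
Qed.

(** For a ghost edge [e^*], the values of [h = g e^*] are recovered from their products
    with edges; on [sigma (y' ⊗ n')] these amount to [h y' = g e^* y'], which is [g]
    times an element of the vertex algebra and so has the degree of [g]. *)
Lemma hom_act i j (f : H) (a : leavitt k F) :
  hom_comp i f -> gr_comp j a -> hom_comp (i + j) ((a : (leavitt k F)^c) *: f).
Proof.
apply: (act_degree (W := H) (Q := hom_comp))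
  => [d n|d g h hg hh n|d g b hg n|d g y hg n|d g e hg n].
- exact: (grading0 gV).
- exact: gm_compD.
- by rewrite hom_mod_vact.
- by rewrite hom_mod_eact; exact: eval_edge_deg.
set h : H := _ *: g; apply: eact_deg_inv => y; rewrite subrK -eval_edgeE.
have [tau [_ ts]] := biiso_inv sigma.
rewrite -[tens n y]ts; have el := eval_edge_lin (h : rhom N V).
elim/tens_ind: (tau _) => [y' n'||t u ht hu].
- rewrite -hom_mod_eact /h /eact scaleLM ghost_edge_alg -/(vact g _) hom_mod_vact.
  exact: hg.
- by rewrite (morphD0 (bihomD sigma)) (morphD0 (rlD el)); exact: (grading0 gV).
- by rewrite (morphDB (bihomD sigma)) (morphDB (rlD el)); exact: (gradingB gV).
Qed.

Definition gr_hom_mod : grmod (leavitt k F) :=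
  @Grmod (leavitt k F) H hom_comp hom_grading hom_act.

End Object.

Definition gr_hom_map (V W : grmod (leavitt k E)) (g : grhom V W) :
    grhom (gr_hom_mod V) (gr_hom_mod W) :=
  @Grhom (leavitt k F) (gr_hom_mod V) (gr_hom_mod W) (hom_map sigma g)
    (fun i f hf n => grh_deg g (hf n)).

Definition gr_hom_functor : functor (Gr (leavitt k E)) (Gr (leavitt k F)).
Proof.
apply: (@Functor (Gr (leavitt k E)) (Gr (leavitt k F)) gr_hom_mod gr_hom_map).
- by move=> V; apply: grhom_ext; exact: (fmap1 (hom_functor sigma)).
- by move=> U V W g f; apply: grhom_ext; exact: (fmapM (hom_functor sigma)).
Defined.

(** Both sides have the same underlying module and the same degree predicate by
    definition. *)
Lemma gr_hom_graded : graded_functor gr_hom_functor.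
Proof.
move=> V d; rewrite /= /gr_hom_mod /susp_mod /=.
by congr Grmod; exact: Prop_irrelevance.
Qed.

Lemma hom_functor_graded : graded_functor_Mod (hom_functor sigma).
Proof.
exists gr_hom_functor; split; first exact: gr_hom_graded.
by rewrite /fun_comp /=; congr Functor; exact: Prop_irrelevance.
Qed.

End GradedHom.

(** * Graded Morita equivalence *)

Lemma fg_bimodule (k : fieldType) (E F : digraph) (hE : no_sinks E)
    (M : bimodule (kE0 k E) (kE0 k F)) (N : bimodule (kE0 k F) (kE0 k E)) m
    (omegaE : biiso (M ⊗ N) (kE1powS k E m)) (omegaF : biiso (N ⊗ M) (kE1powS k F m)) :
  fg_right N.
Proof.
have [lam [lD ll [p lp]]] := kE1pow_split k hE m.
have [tauE [_ Eot]] := biiso_inv omegaE.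
have [tauF [Fto _]] := biiso_inv omegaF.
apply: (@fg_factor k (kE0 k E) (kE0 k F) M N (fun t => lam (omegaE t))).
- by move=> x y; rewrite bihomD lD.
- by move=> a x; rewrite bihom_l ll.
- by exists (tauE p); rewrite Eot.
- apply: (fg_surj (f := tauF)) (fg_kE1pow k F m) => y; by exists (omegaF y).
Qed.

Theorem theorem6p7 (k : fieldType) (E F : digraph)
    (hE : no_sinks E) (hF : no_sinks F)
    (M : bimodule (kE0 k E) (kE0 k F)) (N : bimodule (kE0 k F) (kE0 k E))
    (n : nat) (hn : (0 < n)%N)
    (omegaE : biiso (M ⊗ N) (kE1pow k E n))
    (omegaF : biiso (N ⊗ M) (kE1pow k F n))
    (sigmaM : biiso (kE1 k E ⊗ M) (M ⊗ kE1 k F))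
    (sigmaN : biiso (kE1 k F ⊗ N) (N ⊗ kE1 k E))
    (hEn : bi_comp (omegaE ⊗m bi_id (kE1 k E)) (sharp sigmaM sigmaN)
           =1 bi_comp (nu k E n) (bi_id (kE1 k E) ⊗m omegaE))
    (hFn : bi_comp (omegaF ⊗m bi_id (kE1 k F)) (sharp sigmaN sigmaM)
           =1 bi_comp (nu k F n) (bi_id (kE1 k F) ⊗m omegaF)) :
  graded_morita_equivalent (leavitt k E) (leavitt k F).
Proof.
left; exists (hom_functor sigmaN); split.
  exact: hom_functor_graded (fg_bimodule hE omegaE omegaF).
exists (hom_functor sigmaM); split; first exact: hom_functor_inverse hEn.
exact: hom_functor_inverse hFn.
Qed.
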